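(* Let $\lambda$ be a real number with $0<|\lambda|<\pi/2$, and let $a,b$ be complex numbers such that $q=e^{-i\lambda}ab$ is a positive real number. Then the shifted hypergeometric function $z\,{}_2F_1(a,b;a+b+1;z)$ is $\lambda$-spirallike if $$(2+\cos2\lambda)\left(2\operatorname{Re}[a+b]-\cos2\lambda-\frac{q}{\cos\lambda}\right)-\left(\operatorname{Im}[a+b]-\sin2\lambda\right)^2\ge0.$$
   Context: $\mathbb{D}=\{z\in\mathbb{C}:|z|<1\}$. For $a,b,c\in\mathbb{C}$ with $c\ne0,-1,-2,\dots$, the Gaussian hypergeometric function is ${}_2F_1(a,b;c;z)=\sum_{n=0}^\infty\frac{(a)_n(b)_n}{(c)_n n!}z^n$ for $z\in\mathbb{D}$, where $(a)_0=1$ and $(a)_n=a(a+1)\cdots(a+n-1)$. For $\lambda\in(-\pi/2,\pi/2)$, an analytic function $f$ on $\mathbb{D}$ with $f(0)=0$, $f'(0)=1$ is called $\lambda$-spirallike if $\operatorname{Re}\left(e^{-i\lambda}\frac{zf'(z)}{f(z)}\right)>0$ for all $z\in\mathbb{D}$ (the quotient taking the value $1$ at $z=0$). *)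

(* Defs.v *)
From Stdlib Require Import Reals Factorial.
From Coquelicot Require Import Coquelicot.
Open Scope C_scope.

Definition Cexp (z : C) : C :=
  RtoC (exp (Re z)) * (cos (Im z), sin (Im z)).

(* Total sum operator for complex series, taken componentwise like [Series];
   it is the actual sum whenever the series converges (CSeries_unique). *)
Definition CSeries (u : nat -> C) : C :=
  (Series (fun n => Re (u n)), Series (fun n => Im (u n))).

Lemma CSeries_unique (u : nat -> C) (l : C) :
  @is_series C_AbsRing C_NormedModule u l -> CSeries u = l.
Proof.
intros H.
assert (Hs : forall n, Re (sum_n (G := C_NormedModule) u n)
                       = sum_n (fun k => Re (u k)) n
                    /\ Im (sum_n (G := C_NormedModule) u n)
                       = sum_n (fun k => Im (u k)) n).
{ intros n; induction n as [|n [IHr IHi]].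
  - rewrite !sum_O; split; reflexivity.
  - rewrite !sum_Sn, <- IHr, <- IHi; split; reflexivity. }
assert (Hl : filterlim (fun n => sum_n (G := C_NormedModule) u n) eventually
               (@locally C_UniformSpace l)).
{ exact H. }
destruct l as [lr li]; unfold CSeries; f_equal; apply is_series_unique;
  intros P [eps HP].
- destruct (Hl (fun z : C => P (Re z))) as [N HN].
  { exists eps; intros z [Hz _]; apply HP; exact Hz. }
  exists N; intros n Hn; exact (eq_ind _ P (HN n Hn) _ (proj1 (Hs n))).
- destruct (Hl (fun z : C => P (Im z))) as [N HN].
  { exists eps; intros z [_ Hz]; apply HP; exact Hz. }
  exists N; intros n Hn; exact (eq_ind _ P (HN n Hn) _ (proj2 (Hs n))).
Qed.

Fixpoint Cpochhammer (a : C) (n : nat) : C :=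
  match n with
  | O => 1
  | S m => Cpochhammer a m * (a + RtoC (INR m))
  end.

(* Meaningful for c <> 0, -1, -2, ... and Cmod z < 1. *)
Definition hyp2F1 (a b c z : C) : C :=
  CSeries (fun n =>
    Cpochhammer a n * Cpochhammer b n
      / (Cpochhammer c n * RtoC (INR (fact n))) * z ^ n).

Definition analytic_on_unit_disc (f : C -> C) : Prop :=
  forall z : C, (Cmod z < 1)%R -> @ex_derive C_AbsRing C_NormedModule f z.

(* z f'(z) / f(z), with its removable singularity at 0 filled in; the value 1
   is the right one for f normalized by f(0) = 0 and f'(0) = 1. *)
Definition zdlog (f : C -> C) (z : C) : C :=
  if Ceq_dec z 0 then 1 else z * C_derive f z / f z.

(* The clause [f z <> 0] says that the quotient in [zdlog] is defined. *)
Definition spirallike (lam : R) (f : C -> C) : Prop :=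
  analytic_on_unit_disc f /\ f 0 = 0 /\ C_derive f 0 = 1 /\
  (forall z : C, (Cmod z < 1)%R -> z <> 0 -> f z <> 0) /\
  (forall z : C, (Cmod z < 1)%R ->
     (0 < Re (Cexp (- Ci * RtoC lam) * zdlog f z))%R).

(* Main.v *)
Require Import Defs.
From Stdlib Require Import Reals.
From Coquelicot Require Import Coquelicot.
From Stdlib Require Import Factorial Lra Lia Classical ClassicalEpsilon List.
Local Open Scope C_scope.

(* Let F = 2F1(a,b;a+b+1;.), G = z F', beta = 2 cos(lam) e^{i lam} and H = G + beta F.
   Spirallikeness of z F means |G| < |H| on the disc.  If this fails, take z0 of
   minimal modulus with |G| = |H|; by uniqueness for the hypergeometric equation
   G and H do not both vanish there, and Jack's lemma for G/H gives
   Re (conj H z H' - conj G z G' + |G|^2) <= 0 at z0.  The choice c = a + b + 1 turns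
   the equation into z^2 F'' + c z F' = a b z/(1-z) F, so with z F'/F =
   e^{i lam} (- cos lam + i y) and Re (z/(1-z)) > -1/2 this says that a quadratic
   polynomial in y is negative; its discriminant is nonpositive by hypothesis. *)

(** * Complex derivatives *)

(** [beta] is chosen so that |w| < |w + beta| is the half-plane Re (e^{-i lam} w) > - cos lam; for w
    = z F'/F this is the spirallike condition, because the logarithmic derivative of z F is 1 + w.
    Stating it as |G| < |H| avoids having to know beforehand that F has no zeros: at a zero of F the
    two sides would coincide, so the strict inequality also delivers the nonvanishing. G is carried
    as z times F', so the division by z in Schwarz's lemma is already done and no removable
    singularity appears. Holomorphy is used only through explicit derivatives: the maximum principle
    comes from the sign of a Laplacian, which costs two derivatives of the quotient F'/H, hence
    three of F, all supplied by termwise differentiation of the power series. *)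

Definition Cderiv (f : C -> C) (z l : C) : Prop :=
  @is_derive C_AbsRing C_NormedModule f z l.

Lemma Cderiv_eps (f : C -> C) (z l : C) :
  Cderiv f z l <->
  (forall eps : R, (0 < eps)%R -> exists d : R, (0 < d)%R /\
     forall h : C, (Cmod h < d)%R ->
       (Cmod (f (z + h) - f z - l * h)%C <= eps * Cmod h)%R).
Proof.
split.
- intros [_ H] eps Heps.
  destruct (H z (fun P HP => HP) (mkposreal eps Heps)) as [d Hd].
  exists d; split; [apply cond_pos|].
  intros h Hh.
  specialize (Hd (z + h)).
  replace (l * h) with (minus (z + h) z * l).
  + replace h with (minus (z + h) z) at 3.
    * apply Hd. 
      change (Cmod (minus (z + h) z)%C < d)%R.
      now replace (minus (z + h) z) with h by (unfold minus, plus, opp; simpl; ring).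
    * unfold minus, plus, opp; simpl; ring.
  + unfold minus, plus, opp; simpl; ring.
- intros H; split; [apply is_linear_scal_l|].
  intros x Hx.
  apply (@is_filter_lim_locally_unique C_AbsRing (AbsRing_NormedModule C_AbsRing)) in Hx; subst x.
  intros eps; destruct (H eps (cond_pos eps)) as [d [Hd0 Hd]].
  exists (mkposreal d Hd0).
  enough (forall y : C, (Cmod (y - z)%C < d)%R ->
    (Cmod (f y - f z - (y - z) * l)%C <= eps * Cmod (y - z)%C)%R) by assumption.
  intros y Hy; specialize (Hd (y - z) Hy).
  replace (z + (y - z)) with y in Hd by ring.
  now rewrite (Cmult_comm (y - z) l).
Qed.

(** The two normed-module structures on the target share the same norm, and the remainder condition
    mentions nothing else. The product and chain rules are stated for the ring structure, the
    theorem for [C_NormedModule]. *)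
Lemma Cderiv_AbsRing (f : C -> C) (z l : C) :
  Cderiv f z l <-> @is_derive C_AbsRing (AbsRing_NormedModule C_AbsRing) f z l.
Proof.
split; intros [_ H]; (split; [apply is_linear_scal_l|exact H]).
Qed.

Lemma Cderiv_ext_eq (f : C -> C) (z l l' : C) :
  l = l' -> Cderiv f z l -> Cderiv f z l'.
Proof. now intros ->. Qed.

Lemma Cderiv_id (z : C) : Cderiv (fun x => x) z 1.
Proof. apply Cderiv_AbsRing, (@is_derive_id C_AbsRing). Qed.

Lemma Cderiv_const (c z : C) : Cderiv (fun _ => c) z 0.
Proof. apply (@is_derive_const C_AbsRing C_NormedModule). Qed.

Lemma Cderiv_plus (f g : C -> C) (z l m : C) :
  Cderiv f z l -> Cderiv g z m -> Cderiv (fun x => f x + g x) z (l + m).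
Proof. apply (@is_derive_plus C_AbsRing C_NormedModule). Qed.

Lemma Cderiv_minus (f g : C -> C) (z l m : C) :
  Cderiv f z l -> Cderiv g z m -> Cderiv (fun x => f x - g x) z (l - m).
Proof. apply (@is_derive_minus C_AbsRing C_NormedModule). Qed.

Lemma Cderiv_mult (f g : C -> C) (z l m : C) :
  Cderiv f z l -> Cderiv g z m ->
  Cderiv (fun x => f x * g x) z (l * g z + f z * m).
Proof.
rewrite !Cderiv_AbsRing; intros Hf Hg.
apply (@is_derive_mult C_AbsRing); auto.
intros x y; apply Cmult_comm.
Qed.

Lemma Cderiv_scal (c : C) (f : C -> C) (z l : C) :
  Cderiv f z l -> Cderiv (fun x => c * f x) z (c * l).
Proof.
intros H; apply (Cderiv_ext_eq _ _ (0 * f z + c * l)); [ring|].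
now apply (Cderiv_mult (fun _ => c)); [apply Cderiv_const|].
Qed.

Lemma Cderiv_Cinv (w : C) : w <> 0 -> Cderiv Cinv w (- / (w * w)).
Proof.
intros Hw; apply Cderiv_eps; intros eps Heps.
assert (Hm : (0 < Cmod w)%R) by now apply Cmod_gt_0.
(* The error is h^2 / (w^2 (w + h)). The first bound gives |w + h| > |w|/2, so the factor of |h| is
   at most 2|h| / |w|^3, which the second bound makes at most [eps]. *)
exists (Rmin (Cmod w / 2) (eps * (Cmod w ^ 3) / 2)); split.
{ apply Rmin_pos; [lra|]; apply Rdiv_lt_0_compat; [|lra].
  apply Rmult_lt_0_compat; [lra|now apply pow_lt]. }
intros h Hh.
assert (H1 : (Cmod h < Cmod w / 2)%R) by (eapply Rlt_le_trans; [exact Hh|apply Rmin_l]).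
assert (H2 : (Cmod h < eps * (Cmod w ^ 3) / 2)%R) by (eapply Rlt_le_trans; [exact Hh|apply Rmin_r]).
assert (H3 : (Cmod w / 2 < Cmod (w + h)%C)%R).
{ assert (T := Cmod_triangle (w + h) (- h)).
  replace (w + h + - h) with w in T by ring; rewrite Cmod_opp in T; lra. }
assert (Hwh : w + h <> 0) by (apply Cmod_gt_0; lra).
replace (/ (w + h) - / w - - / (w * w) * h) with (h * (h / (w * w * (w + h))))
  by (field; auto).
rewrite Cmod_mult, Cmod_div, !Cmod_mult by (repeat apply Cmult_neq_0; auto).
rewrite (Rmult_comm (Cmod h)); apply Rmult_le_compat_r; [apply Cmod_ge_0|].
apply Rle_div_l; [apply Rmult_lt_0_compat; [nra|lra]|].
apply Rlt_le, (Rlt_le_trans _ _ _ H2).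
replace (eps * Cmod w ^ 3 / 2)%R with (eps * (Cmod w * Cmod w * (Cmod w / 2)))%R by field.
apply Rmult_le_compat_l; [lra|]; apply Rmult_le_compat_l; nra.
Qed.

Lemma Cderiv_div (f g : C -> C) (z l m : C) :
  g z <> 0 -> Cderiv f z l -> Cderiv g z m ->
  Cderiv (fun x => f x / g x) z ((l * g z - f z * m) / (g z * g z)).
Proof.
intros Hg Df Dg.
apply (Cderiv_ext_eq _ _ (l * / g z + f z * (m * - / (g z * g z)))); [now field|].
apply (Cderiv_mult f (fun x => / g x)); [exact Df|].
exact (@is_derive_comp C_AbsRing C_NormedModule Cinv g z _ _
  (Cderiv_Cinv _ Hg) (proj1 (Cderiv_AbsRing _ _ _) Dg)).
Qed.

Lemma Cderiv_C_derive (f : C -> C) (z l : C) : Cderiv f z l -> C_derive f z = l.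
Proof. intros H; apply is_C_derive_unique; exact H. Qed.

Lemma Cderiv_continuous (f : C -> C) (z l : C) : Cderiv f z l ->
  forall eps : R, (0 < eps)%R -> exists d : R, (0 < d)%R /\
    forall y : C, (Cmod (y - z)%C < d)%R -> (Cmod (f y - f z)%C < eps)%R.
Proof.
intros H eps Heps.
destruct (proj1 (Cderiv_eps _ _ _) H 1%R Rlt_0_1) as [d [Hd0 Hd]].
set (K := (1 + Cmod l)%R).
assert (HK : (0 < K)%R) by (unfold K; generalize (Cmod_ge_0 l); lra).
exists (Rmin d (eps / K)); split.
{ apply Rmin_pos; [lra|now apply Rdiv_lt_0_compat]. }
intros y Hy.
assert (H1 : (Cmod (y - z)%C < d)%R) by (eapply Rlt_le_trans; [exact Hy|apply Rmin_l]).
assert (H2 : (Cmod (y - z)%C < eps / K)%R) by (eapply Rlt_le_trans; [exact Hy|apply Rmin_r]).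
specialize (Hd _ H1); replace (z + (y - z)) with y in Hd by ring.
assert (T := Cmod_triangle (f y - f z - l * (y - z)) (l * (y - z))).
replace (f y - f z - l * (y - z) + l * (y - z)) with (f y - f z) in T by ring.
rewrite Cmod_mult in T.
apply Rlt_div_r in H2; [|lra].
unfold K in H2; lra.
Qed.

(** The real inner product of the plane. Squared moduli written with it stay differentiable along
    real lines even at zeros, where [Cmod] is not. *)
Definition Cdot (x y : C) : R := Re (Cconj x * y)%C.

Lemma Cdot_diag (x : C) : Cdot x x = (Cmod x ^ 2)%R.
Proof. rewrite Cmod2_alt; destruct x; unfold Cdot; simpl; ring. Qed.

Lemma is_derive_line (f : C -> C) (z v l : C) (t : R) :
  Cderiv f (z + RtoC t * v) l ->
  is_derive (fun s : R => Re (f (z + RtoC s * v))%C) t (Re (l * v)%C) /\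
  is_derive (fun s : R => Im (f (z + RtoC s * v))%C) t (Im (l * v)%C).
Proof.
intros H.
assert (Key : forall eps : R, (0 < eps)%R -> exists d : R, (0 < d)%R /\
   forall h : R, h <> 0%R -> (Rabs h < d)%R ->
   (Cmod ((f (z + RtoC (t + h) * v) - f (z + RtoC t * v)) - RtoC h * (l * v))%C < eps * Rabs h)%R).
{ intros eps Heps.
  (* The summand 1 keeps [K] positive when [v = 0] and makes the final estimate strict, as the real
     derivative requires. *)
  set (K := (1 + Cmod v)%R).
  assert (HK : (0 < K)%R) by (unfold K; generalize (Cmod_ge_0 v); lra).
  assert (HeK : (0 < eps / K)%R) by now apply Rdiv_lt_0_compat.
  destruct (proj1 (Cderiv_eps _ _ _) H _ HeK) as [d [Hd0 Hd]].
  exists (d / K)%R; split; [now apply Rdiv_lt_0_compat|].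
  intros h Hh0 Hh; apply Rabs_pos_lt in Hh0.
  assert (Hn : (Cmod (RtoC h * v)%C <= Rabs h * Cmod v)%R)
    by (rewrite Cmod_mult, Cmod_R; lra).
  apply Rlt_div_r in Hh; [|lra].
  assert (H1 : (Cmod (RtoC h * v)%C < d)%R) by (unfold K in Hh; lra).
  specialize (Hd _ H1).
  replace (z + RtoC (t + h) * v) with (z + RtoC t * v + RtoC h * v)
    by (rewrite RtoC_plus; ring).
  replace (RtoC h * (l * v)) with (l * (RtoC h * v)) by ring.
  apply (Rle_lt_trans _ _ _ Hd).
  apply (Rle_lt_trans _ (eps / K * (Rabs h * Cmod v))).
  - apply Rmult_le_compat_l; lra.
  - replace (eps * Rabs h)%R with (eps / K * (Rabs h * K))%R by (field; lra).
    apply Rmult_lt_compat_l; [lra|]; unfold K; nra. }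
split; apply is_derive_Reals; intros eps Heps;
  destruct (Key eps Heps) as [d [Hd0 Hd]]; exists (mkposreal d Hd0);
  intros h Hh0 Hh; specialize (Hd h Hh0 Hh).
- set (u := f (z + RtoC (t + h) * v)) in *; set (w := f (z + RtoC t * v)) in *.
  replace ((Re u - Re w) / h - Re (l * v)%C)%R
    with (Re (u - w - RtoC h * (l * v))%C / h)%R.
  + rewrite Rabs_div by auto; apply Rlt_div_l; [now apply Rabs_pos_lt|].
    eapply Rle_lt_trans; [apply re_le_Cmod|exact Hd].
  + destruct u, w, (l * v); simpl; field; auto.
- set (u := f (z + RtoC (t + h) * v)) in *; set (w := f (z + RtoC t * v)) in *.
  replace ((Im u - Im w) / h - Im (l * v)%C)%R
    with (Im (u - w - RtoC h * (l * v))%C / h)%R.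
  + rewrite Rabs_div by auto; apply Rlt_div_l; [now apply Rabs_pos_lt|].
    eapply Rle_lt_trans; [|exact Hd].
    eapply Rle_trans; [|apply Rmax_Cmod]; apply Rmax_r.
  + destruct u, w, (l * v); simpl; field; auto.
Qed.

Lemma is_derive_Cdot_line (f g : C -> C) (z v l m : C) (t : R) :
  Cderiv f (z + RtoC t * v) l -> Cderiv g (z + RtoC t * v) m ->
  is_derive (fun s : R => Cdot (f (z + RtoC s * v))%C (g (z + RtoC s * v))%C) t
    (Cdot (l * v)%C (g (z + RtoC t * v))%C + Cdot (f (z + RtoC t * v))%C (m * v)%C)%R.
Proof.
intros Hf Hg.
destruct (is_derive_line _ _ _ _ _ Hf) as [f1 f2].
destruct (is_derive_line _ _ _ _ _ Hg) as [g1 g2].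
apply (is_derive_ext (fun s : R =>
  Re (f (z + RtoC s * v))%C * Re (g (z + RtoC s * v))%C +
  Im (f (z + RtoC s * v))%C * Im (g (z + RtoC s * v))%C)%R).
{ intros s; unfold Cdot; destruct (f _), (g _); simpl; ring. }
refine (eq_ind _ (fun d : R => is_derive _ t d)
  (@is_derive_plus _ _ _ _ _ _ _ (is_derive_mult _ _ _ _ _ f1 g1 Rmult_comm)
     (is_derive_mult _ _ _ _ _ f2 g2 Rmult_comm)) _ _).
unfold plus, mult, Cdot; simpl.
destruct (f _), (g _), l, m, v; simpl; ring.
Qed.

(** * Complex power series on the unit disc *)

Definition is_Cseries (u : nat -> C) (l : C) : Prop :=
  @is_series C_AbsRing C_NormedModule u l.

Lemma is_Cseries_plus (u v : nat -> C) (l m : C) :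
  is_Cseries u l -> is_Cseries v m -> is_Cseries (fun n => u n + v n) (l + m).
Proof. apply (@is_series_plus C_AbsRing C_NormedModule). Qed.

Lemma is_Cseries_scal (c : C) (u : nat -> C) (l : C) :
  is_Cseries u l -> is_Cseries (fun n => c * u n) (c * l).
Proof. apply (@is_series_scal C_AbsRing C_NormedModule). Qed.

Lemma is_Cseries_ext (u v : nat -> C) (l : C) :
  (forall n, u n = v n) -> is_Cseries u l -> is_Cseries v l.
Proof. apply (@is_series_ext C_AbsRing C_NormedModule). Qed.

Lemma is_Cseries_incr_1 (u : nat -> C) (l : C) :
  is_Cseries (fun n => u (S n)) l -> is_Cseries u (u O + l).
Proof.
intros H; apply (@is_series_decr_1 C_AbsRing C_NormedModule).
refine (eq_ind l (fun x => is_Cseries (fun n => u (S n)) x) H _ _).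
change (l = u O + l + - u O); ring.
Qed.

Lemma is_Cseries_bound (u : nat -> C) (l : C) (b : nat -> R) (B : R) :
  is_Cseries u l -> (forall n, (Cmod (u n)%C <= b n)%R) -> is_series b B ->
  (Cmod l <= B)%R.
Proof.
intros Hu Hb HB.
assert (H1 : is_lim_seq (fun n => Cmod (sum_n (G := C_NormedModule) u n)%C) (Cmod l)).
{ apply (filterlim_comp _ _ _ (sum_n (G := C_NormedModule) u) Cmod eventually
    (@locally C_NormedModule l)); [exact Hu|].
  exact (@filterlim_norm C_AbsRing C_NormedModule l). }
assert (H2 : is_lim_seq (sum_n b) B) by exact HB.
refine (is_lim_seq_le _ _ _ _ _ H1 H2); intros n; unfold sum_n.
eapply Rle_trans; [apply (@norm_sum_n_m C_AbsRing C_NormedModule)|].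
apply sum_n_m_le; exact Hb.
Qed.

Lemma ex_Cseries_bound (u : nat -> C) (b : nat -> R) :
  (forall n, (Cmod (u n)%C <= b n)%R) -> ex_series b -> is_Cseries u (CSeries u).
Proof.
intros Hb HB.
destruct (@ex_series_le C_AbsRing C_CompleteNormedModule u b Hb HB) as [l Hl].
now rewrite (CSeries_unique u l Hl).
Qed.

(** Comparison with a geometric series of ratio 0 gives convergence to some sum; scaling by 0
    identifies that sum. *)
Lemma is_Cseries_0 : is_Cseries (fun _ => 0) 0.
Proof.
assert (H := is_Cseries_scal 0 (fun _ => 0) _
  (ex_Cseries_bound (fun _ => 0) (fun n => 0 ^ n)%R
    ltac:(intros n; cbv beta; rewrite Cmod_0; apply pow_le; lra)
    ltac:(apply ex_series_geom; rewrite Rabs_R0; lra))).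
now rewrite !Cmult_0_l in H.
Qed.

(* Every such [A] has radius of convergence at least 1. *)
Definition disc_coeff (A : nat -> C) : Prop :=
  forall rho : R, (0 < rho < 1)%R ->
    exists M : R, forall n, (Cmod (A n)%C * rho ^ n <= M)%R.

Lemma disc_coeff_plus (A B : nat -> C) :
  disc_coeff A -> disc_coeff B -> disc_coeff (fun n => A n + B n).
Proof.
intros HA HB rho Hr.
destruct (HA rho Hr) as [M HM], (HB rho Hr) as [N HN].
exists (M + N)%R; intros n.
specialize (HM n); specialize (HN n).
assert (T := Cmod_triangle (A n) (B n)).
assert (0 <= rho ^ n)%R by (apply pow_le; lra).
nra.
Qed.

Lemma disc_coeff_scal (c : C) (A : nat -> C) :
  disc_coeff A -> disc_coeff (fun n => c * A n).
Proof.
intros HA rho Hr; destruct (HA rho Hr) as [M HM].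
exists (Cmod c * M)%R; intros n; rewrite Cmod_mult, Rmult_assoc.
apply Rmult_le_compat_l; [apply Cmod_ge_0|apply HM].
Qed.

Lemma disc_coeff_shift (A : nat -> C) :
  disc_coeff A -> disc_coeff (fun n => A (S n)).
Proof.
intros HA rho Hr; destruct (HA rho Hr) as [M HM].
exists (M / rho)%R; intros n.
apply (Rle_div_r _ _ rho); [lra|].
eapply Rle_trans; [|apply (HM (S n))]; apply Req_le; simpl; ring.
Qed.

(** The factor n is absorbed by enlarging the radius from rho to (1 + rho)/2 = rho (1 + h):
    Bernoulli's inequality gives n h <= (1 + h)^n. *)
Lemma disc_coeff_theta (A : nat -> C) :
  disc_coeff A -> disc_coeff (fun n => RtoC (INR n) * A n).
Proof.
intros HA rho Hr.
destruct (HA ((1 + rho) / 2)%R ltac:(lra)) as [M HM].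
set (h := ((1 - rho) / (2 * rho))%R).
assert (Hh : (0 < h)%R) by (apply Rdiv_lt_0_compat; lra).
exists (M / h)%R; intros n; specialize (HM n).
replace ((1 + rho) / 2)%R with (rho * (1 + h))%R in HM by (unfold h; field; lra).
rewrite Rpow_mult_distr in HM.
assert (Hn := poly n h Hh).
rewrite Cmod_mult, Cmod_R, Rabs_pos_eq by apply pos_INR.
apply (Rle_div_r _ _ h); [lra|].
assert (HX : (0 <= Cmod (A n)%C * rho ^ n)%R)
  by (apply Rmult_le_pos; [apply Cmod_ge_0|apply pow_le; lra]).
nra.
Qed.

Definition der_coeff (A : nat -> C) (n : nat) : C := RtoC (INR (S n)) * A (S n).

Lemma disc_coeff_der (A : nat -> C) : disc_coeff A -> disc_coeff (der_coeff A).
Proof. intros H; apply (disc_coeff_shift _ (disc_coeff_theta _ H)). Qed.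

Definition CPSeries (A : nat -> C) (z : C) : C := CSeries (fun n => A n * z ^ n).

(** Boundedness at the larger radius (1 + rho)/2 gives domination by a geometric series whose ratio
    [k] is the quotient of the radii. *)
Lemma disc_coeff_abs_conv (A : nat -> C) (rho : R) :
  disc_coeff A -> (0 <= rho < 1)%R -> ex_series (fun n => (Cmod (A n)%C * rho ^ n)%R).
Proof.
intros HA Hr.
destruct (HA ((1 + rho) / 2)%R ltac:(lra)) as [M HM].
set (k := (rho / ((1 + rho) / 2))%R).
assert (Hk : (0 <= k < 1)%R).
{ unfold k; split; [apply Rdiv_le_0_compat; lra|apply Rlt_div_l; lra]. }
apply (@ex_series_le R_AbsRing R_CompleteNormedModule _ (fun n => (M * k ^ n)%R)).
- intros n; specialize (HM n).
  assert (HX : (0 <= Cmod (A n)%C * rho ^ n)%R)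
    by (apply Rmult_le_pos; [apply Cmod_ge_0|apply pow_le; lra]).
  change (norm (Cmod (A n)%C * rho ^ n)%R) with (Rabs (Cmod (A n)%C * rho ^ n)).
  rewrite Rabs_pos_eq by exact HX.
  replace (rho ^ n)%R with (((1 + rho) / 2) ^ n * k ^ n)%R.
  + assert (0 <= k ^ n)%R by (apply pow_le; lra); nra.
  + rewrite <- Rpow_mult_distr; f_equal; unfold k; field; lra.
- apply (@ex_series_scal R_AbsRing R_NormedModule M), ex_series_geom.
  rewrite Rabs_pos_eq; lra.
Qed.

Lemma CPSeries_correct (A : nat -> C) (z : C) : disc_coeff A -> (Cmod z < 1)%R ->
  is_Cseries (fun n => A n * z ^ n) (CPSeries A z).
Proof.
intros HA Hz; apply (ex_Cseries_bound _ (fun n => (Cmod (A n)%C * Cmod z ^ n)%R)).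
- intros n; rewrite Cmod_mult, Cmod_pow; apply Rle_refl.
- apply disc_coeff_abs_conv; [exact HA|split; [apply Cmod_ge_0|exact Hz]].
Qed.

Lemma CPSeries_unique (A : nat -> C) (z l : C) :
  is_Cseries (fun n => A n * z ^ n) l -> CPSeries A z = l.
Proof. apply CSeries_unique. Qed.

Lemma CPSeries_ext (A B : nat -> C) (z : C) :
  (forall n, A n = B n) -> CPSeries A z = CPSeries B z.
Proof.
intros H; unfold CPSeries, CSeries; f_equal; apply Series_ext;
  intros n; now rewrite H.
Qed.

Lemma CPSeries_0 (A : nat -> C) : CPSeries A 0 = A O.
Proof.
apply CPSeries_unique.
assert (H := is_Cseries_incr_1 (fun n => A n * 0 ^ n) 0).
simpl in H; rewrite Cmult_1_r, Cplus_0_r in H; apply H.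
apply (is_Cseries_ext (fun _ => 0)); [intros; ring|apply is_Cseries_0].
Qed.

Lemma CPSeries_plus (A B : nat -> C) (z : C) :
  disc_coeff A -> disc_coeff B -> (Cmod z < 1)%R ->
  CPSeries (fun n => A n + B n) z = CPSeries A z + CPSeries B z.
Proof.
intros HA HB Hz; apply CPSeries_unique.
apply (is_Cseries_ext (fun n => A n * z ^ n + B n * z ^ n)); [intros; ring|].
now apply is_Cseries_plus; apply CPSeries_correct.
Qed.

Lemma CPSeries_scal (c : C) (A : nat -> C) (z : C) :
  disc_coeff A -> (Cmod z < 1)%R ->
  CPSeries (fun n => c * A n) z = c * CPSeries A z.
Proof.
intros HA Hz; apply CPSeries_unique.
apply (is_Cseries_ext (fun n => c * (A n * z ^ n))); [intros; ring|].
now apply is_Cseries_scal, CPSeries_correct.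
Qed.

Lemma CPSeries_decr_1 (A : nat -> C) (z : C) :
  disc_coeff A -> (Cmod z < 1)%R ->
  CPSeries A z = A O + z * CPSeries (fun n => A (S n)) z.
Proof.
intros HA Hz; apply CPSeries_unique.
replace (A O) with (A O * z ^ 0) by (simpl; ring).
apply (is_Cseries_incr_1 (fun n => A n * z ^ n)).
apply (is_Cseries_ext (fun n => z * (A (S n) * z ^ n))); [intros; simpl; ring|].
apply is_Cseries_scal, CPSeries_correct; [|exact Hz].
now apply disc_coeff_shift.
Qed.

Lemma CPSeries_theta (A : nat -> C) (z : C) :
  disc_coeff A -> (Cmod z < 1)%R ->
  CPSeries (fun n => RtoC (INR n) * A n) z = z * CPSeries (der_coeff A) z.
Proof.
intros HA Hz; rewrite CPSeries_decr_1 by (auto; now apply disc_coeff_theta).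
change (RtoC 0 * A O + z * CPSeries (der_coeff A) z = z * CPSeries (der_coeff A) z); ring.
Qed.

(** Induction on e_{n+1} = w e_n + (n+2) z^{n+1} (w - z)^2 for the remainders e_n. The sharp factor
    1/2 is dropped, so that the constants are exactly those of the twice differentiated series. *)
Lemma Cpow_taylor (z w : C) (rho : R) (n : nat) :
  (Cmod z <= rho)%R -> (Cmod w <= rho)%R ->
  (Cmod (w ^ S (S n) - z ^ S (S n) - RtoC (INR (S (S n))) * z ^ S n * (w - z))%C
     <= INR (S (S n)) * INR (S n) * rho ^ n * Cmod (w - z)%C ^ 2)%R.
Proof.
intros Hz Hw.
assert (H0 : (0 <= rho)%R) by (generalize (Cmod_ge_0 z); lra).
induction n as [|n IH].
- replace (w ^ 2 - z ^ 2 - RtoC (INR 2) * z ^ 1 * (w - z)) with ((w - z) * (w - z))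
    by (simpl Cpow; change (INR 2) with (1 + 1)%R; rewrite RtoC_plus; ring).
  rewrite Cmod_mult; simpl; generalize (Cmod_ge_0 (w - z)); nra.
- set (e := w ^ S (S n) - z ^ S (S n) - RtoC (INR (S (S n))) * z ^ S n * (w - z)) in *.
  replace (w ^ S (S (S n)) - z ^ S (S (S n)) - RtoC (INR (S (S (S n)))) * z ^ S (S n) * (w - z))
    with (w * e + RtoC (INR (S (S n))) * z ^ S n * ((w - z) * (w - z)))
    by (unfold e; rewrite (S_INR (S (S n))), RtoC_plus; simpl Cpow; ring).
  eapply Rle_trans; [apply Cmod_triangle|].
  rewrite !Cmod_mult, Cmod_pow, Cmod_R, Rabs_pos_eq by apply pos_INR.
  assert (Hp : (Cmod z ^ S n <= rho ^ S n)%R)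
    by (apply pow_incr; split; [apply Cmod_ge_0|exact Hz]).
  assert (Hr : (0 <= rho ^ n)%R) by now apply pow_le.
  assert (Hr' : (0 <= rho ^ S n)%R) by now apply pow_le.
  set (D := Cmod (w - z)%C) in *.
  assert (HD : (0 <= D)%R) by apply Cmod_ge_0.
  apply (Rle_trans _ (rho * (INR (S (S n)) * INR (S n) * rho ^ n * D ^ 2)
                      + INR (S (S n)) * rho ^ S n * (D * D))).
  + apply Rplus_le_compat.
    * apply Rmult_le_compat; auto using Cmod_ge_0.
    * apply Rmult_le_compat_r; [nra|].
      apply Rmult_le_compat_l; [apply pos_INR|exact Hp].
  + replace (rho * (INR (S (S n)) * INR (S n) * rho ^ n * D ^ 2)
                      + INR (S (S n)) * rho ^ S n * (D * D))%R
      with (INR (S (S n)) * (INR (S n) + 1) * (rho ^ S n * D ^ 2))%R by (simpl pow; ring).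
    replace (INR (S (S (S n))) * INR (S (S n)) * rho ^ S n * D ^ 2)%R
      with (INR (S (S n)) * INR (S (S (S n))) * (rho ^ S n * D ^ 2))%R by ring.
    apply Rmult_le_compat_r; [apply Rmult_le_pos; nra|].
    apply Rmult_le_compat_l; [apply pos_INR|].
    rewrite (S_INR (S (S n))), (S_INR (S n)); lra.
Qed.

(** The remainder is the sum of the termwise Taylor remainders, hence at most |h|^2 [B], where [B]
    is the absolute sum of the second derivative series at a radius [rho] between |z| and 1. *)
Lemma CPSeries_derive (A : nat -> C) (z : C) : disc_coeff A -> (Cmod z < 1)%R ->
  Cderiv (CPSeries A) z (CPSeries (der_coeff A) z).
Proof.
intros HA Hz; apply Cderiv_eps; intros eps Heps.
set (rho := ((1 + Cmod z) / 2)%R).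
assert (Hz0 := Cmod_ge_0 z).
assert (Hr : (0 <= rho < 1)%R) by (unfold rho; lra).
destruct (disc_coeff_abs_conv _ _ (disc_coeff_der _ (disc_coeff_der _ HA)) Hr) as [B HB].
assert (HB0 : (0 <= B)%R).
{ apply (@is_Cseries_bound (fun _ => 0) 0) in HB.
  - rewrite Cmod_0 in HB; exact HB.
  - exact is_Cseries_0.
  - intros n; rewrite Cmod_0; apply Rmult_le_pos; [apply Cmod_ge_0|apply pow_le; lra]. }
(* The first bound keeps z + h within radius [rho], the second gives |h| B <= eps; [B + 1] guards
   against [B = 0]. *)
exists (Rmin ((1 - Cmod z) / 2) (eps / (B + 1))); split.
{ apply Rmin_pos; [lra|apply Rdiv_lt_0_compat; lra]. }
intros h Hh.
assert (H1 : (Cmod h < (1 - Cmod z) / 2)%R) by (eapply Rlt_le_trans; [exact Hh|apply Rmin_l]).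
assert (H2 : (Cmod h < eps / (B + 1))%R) by (eapply Rlt_le_trans; [exact Hh|apply Rmin_r]).
apply Rlt_div_r in H2; [|lra].
assert (H3 : (Cmod (z + h)%C <= rho)%R)
  by (eapply Rle_trans; [apply Cmod_triangle|unfold rho; lra]).
assert (H4 : (Cmod z <= rho)%R) by (unfold rho; lra).
apply (Rle_trans _ (Cmod h ^ 2 * B)).
2: { generalize (Cmod_ge_0 h); simpl; nra. }
apply (is_Cseries_bound
  (fun n => A (S (S n)) * ((z + h) ^ S (S n) - z ^ S (S n)
       - RtoC (INR (S (S n))) * z ^ S n * ((z + h) - z)))
  _ (fun n => Cmod h ^ 2 * (Cmod (der_coeff (der_coeff A) n)%C * rho ^ n))%R).
3: now apply (@is_series_scal R_AbsRing R_NormedModule).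
- assert (HA1 := disc_coeff_shift _ HA).
  assert (HA2 := disc_coeff_shift _ HA1).
  (* Terms of degree 0 and 1 have zero Taylor remainder. They are split off so that the remaining
     index matches [Cpow_taylor]. *)
  rewrite !(CPSeries_decr_1 A) by (auto; lra).
  rewrite !(CPSeries_decr_1 (fun n => A (S n))) by (auto; lra).
  rewrite (CPSeries_decr_1 (der_coeff A)) by (auto using disc_coeff_der).
  set (X := CPSeries _ (z + h)); set (Y := CPSeries _ z); set (Z := CPSeries _ z).
  apply (is_Cseries_ext (fun n =>
     (z + h) ^ 2 * (A (S (S n)) * (z + h) ^ n) +
     ((- z ^ 2) * (A (S (S n)) * z ^ n) + (- h * z) * (der_coeff A (S n) * z ^ n)))).
  { intros n; unfold der_coeff; simpl Cpow; ring. }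
  replace (A 0%nat + (z + h) * (A 1%nat + (z + h) * X) -
     (A 0%nat + z * (A 1%nat + z * Y)) - (der_coeff A 0 + z * Z) * h)
    with ((z + h) ^ 2 * X + ((- z ^ 2) * Y + (- h * z) * Z))
    by (unfold der_coeff; simpl; ring).
  assert (HzH : (Cmod (z + h)%C < 1)%R) by lra.
  apply is_Cseries_plus; [|apply is_Cseries_plus]; apply is_Cseries_scal;
    apply CPSeries_correct; auto.
  apply (disc_coeff_shift (der_coeff A)), disc_coeff_der, HA.
- intros n; rewrite Cmod_mult.
  assert (T := Cpow_taylor z (z + h) rho n H4 H3).
  replace (z + h - z) with h in * by ring.
  unfold der_coeff at 1; unfold der_coeff; rewrite !Cmod_mult, !Cmod_R, !Rabs_pos_eq by apply pos_INR.
  apply (Rmult_le_compat_l (Cmod (A (S (S n)))%C)) in T; [|apply Cmod_ge_0].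
  eapply Rle_trans; [exact T|apply Req_le; ring].
Qed.

(** * Weak maximum modulus principle *)

(** Without a maximum, every point has a neighbourhood on which [f] restricted to [K] stays below
    the value at some picked point of [K]. A finite subcover leaves finitely many picked points, and
    the best of them beats itself. Upper semicontinuity along [K] is enough. *)
Lemma compact_attains_max (K : C -> Prop) (f : C -> R) (rad : R) :
  (forall z, K z -> (Cmod z <= rad)%R) ->
  (forall z, ~ K z -> exists d : R, (0 < d)%R /\
     forall y, (Cmod (y - z)%C < d)%R -> ~ K y) ->
  (forall z, K z -> forall eps : R, (0 < eps)%R -> exists d : R, (0 < d)%R /\
     forall y, K y -> (Cmod (y - z)%C < d)%R -> (f y < f z + eps)%R) ->
  (exists z, K z) ->
  exists z, K z /\ forall y, K y -> (f y <= f z)%R.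
Proof.
intros Hbd Hcl Hf [k0 Hk0].
apply NNPP; intros Hno.
assert (Hbig : forall z, K z -> exists z', K z' /\ (f z < f z')%R).
{ intros z Hz; apply NNPP; intros Hn; apply Hno; exists z; split; [exact Hz|].
  intros y Hy; apply Rnot_lt_le; intros Hlt; apply Hn; now exists y. }
(* The cover is by squares of half-side [fst p]; the doubled radius leaves room for the factor sqrt
   2 between the sup norm and the modulus. *)
assert (Hloc : forall z : C, exists p : posreal * C, K (snd p) /\
  forall y, K y -> (Cmod (y - z)%C < 2 * fst p)%R -> (f y < f (snd p))%R).
{ intros z; destruct (classic (K z)) as [Hz|Hz].
  - destruct (Hbig z Hz) as [z' [Hz' Hlt]].
    destruct (Hf z Hz (f z' - f z)%R ltac:(lra)) as [d [Hd0 Hd]].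
    exists (mkposreal (d / 2) ltac:(lra), z'); simpl; split; [exact Hz'|].
    intros y Hy Hyz; specialize (Hd y Hy ltac:(lra)); lra.
  - destruct (Hcl z Hz) as [d [Hd0 Hd]].
    exists (mkposreal (d / 2) ltac:(lra), k0); simpl; split; [exact Hk0|].
    intros y Hy Hyz; exfalso; apply (Hd y); [lra|exact Hy]. }
set (pick := fun z => proj1_sig (constructive_indefinite_description _ (Hloc z))).
assert (Hpick : forall z, K (snd (pick z)) /\
  forall y, K y -> (Cmod (y - z)%C < 2 * fst (pick z))%R -> (f y < f (snd (pick z)))%R)
  by (intros z; apply (proj2_sig (constructive_indefinite_description _ (Hloc z)))).
set (toC := fun t : Compactness.Tn 2 R => (fst t, fst (snd t)) : C).
apply (compactness_list 2 (- rad, (- rad, tt))%R (rad, (rad, tt))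
  (fun t => fst (pick (toC t)))).
intros [l Hl].
assert (Hmax : exists w, K w /\ forall t, In t l -> (f (snd (pick (toC t))) <= f w)%R).
{ clear Hl; induction l as [|t l [w [Hw IH]]].
  - exists k0; split; [exact Hk0|intros t []].
  - destruct (Rle_lt_dec (f (snd (pick (toC t)))) (f w)) as [Hle|Hlt].
    + exists w; split; [exact Hw|]; intros s [<-|Hs]; auto.
    + exists (snd (pick (toC t))); split; [apply Hpick|].
      intros s [<-|Hs]; [lra|]; specialize (IH s Hs); lra. }
destruct Hmax as [w [Hw Hmax]].
assert (Hwr := Hbd w Hw).
assert (Hw12 := Rmax_Cmod w).
assert (H1 := Rmax_l (Rabs (fst w)) (Rabs (snd w))).
assert (H2 := Rmax_r (Rabs (fst w)) (Rabs (snd w))).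
destruct (Hl (fst w, (snd w, tt))) as [t [Ht [_ Hc]]].
{ split; [|split; [|exact I]]; apply Rabs_le_between; lra. }
specialize (Hmax t Ht).
apply (Rle_not_lt _ _ Hmax), (proj2 (Hpick (toC t)) w Hw).
destruct t as [t1 [t2 []]], w as [w1 w2]; unfold toC in *; simpl in *.
set (d := fst (pick (t1, t2))) in *.
assert (Hd := cond_pos d).
destruct Hc as [Hc1 [Hc2 _]].
eapply Rle_lt_trans; [apply Cmod_2Rmax|].
simpl.
assert (Hs : (sqrt 2 <= 2)%R).
{ rewrite <- (sqrt_square 2) at 2 by lra; apply sqrt_le_1_alt; lra. }
assert (Hs0 := sqrt_pos 2).
assert (HR : (0 <= Rmax (Rabs (w1 + - t1)) (Rabs (w2 + - t2)) < d)%R).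
{ split; [eapply Rle_trans; [apply Rabs_pos|apply Rmax_l]|].
  apply Rmax_lub_lt; assumption. }
nra.
Qed.

(** The point 0 need not be critical: [g1] has positive slope at 0, so [g] increases to the right if
    [g1 0 >= 0], and increases to the left if [g1 0 < 0]. *)
Lemma positive_second_derivative (g g1 : R -> R) (d k : R) :
  (0 < d)%R -> (0 < k)%R ->
  (forall t, (Rabs t < d)%R -> is_derive g t (g1 t)) -> is_derive g1 0%R k ->
  exists t, (Rabs t < d)%R /\ (g 0 < g t)%R.
Proof.
intros Hd Hk Hg Hg1.
apply is_derive_Reals in Hg1.
destruct (Hg1 (k / 2)%R ltac:(lra)) as [e He].
assert (He0 := cond_pos e).
set (t := (Rmin d e / 2)%R).
assert (Ht0 : (0 < Rmin d e)%R) by now apply Rmin_pos.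
assert (Ht1 := Rmin_l d e); assert (Ht2 := Rmin_r d e).
assert (Hq : forall c, c <> 0%R -> (Rabs c < e)%R -> (k / 2 < (g1 c - g1 0) / c)%R).
{ intros c Hc0 Hc; specialize (He c Hc0 Hc); rewrite Rplus_0_l in He.
  apply Rabs_lt_between in He; lra. }
destruct (Rle_lt_dec 0 (g1 0)) as [H0|H0].
- exists t; assert (Ht : (Rabs t < d)%R) by (rewrite Rabs_pos_eq; unfold t; lra).
  split; [exact Ht|].
  destruct (MVT_cor2 g g1 0 t) as [c [Hc Hct]]; [unfold t; lra| |].
  { intros c Hc; apply is_derive_Reals, Hg; rewrite Rabs_pos_eq; unfold t in *; lra. }
  assert (Hqc := Hq c ltac:(lra) ltac:(rewrite Rabs_pos_eq; unfold t in *; lra)).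
  apply (Rlt_div_r _ _ c) in Hqc; [|lra].
  assert (0 < g1 c)%R by nra; nra.
- exists (- t)%R; assert (Ht : (Rabs (- t) < d)%R)
    by (rewrite Rabs_Ropp, Rabs_pos_eq; unfold t; lra).
  split; [exact Ht|].
  destruct (MVT_cor2 g g1 (- t) 0) as [c [Hc Hct]]; [unfold t; lra| |].
  { intros c Hc; apply is_derive_Reals, Hg.
    rewrite Rabs_left1; unfold t in *; lra. }
  assert (Hqc := Hq c ltac:(lra) ltac:(rewrite Rabs_left1; unfold t in *; lra)).
  replace ((g1 c - g1 0) / c)%R with ((g1 0 - g1 c) / - c)%R in Hqc by (field; lra).
  apply (Rlt_div_r _ _ (- c)) in Hqc; [|lra].
  assert (g1 c < 0)%R by nra; nra.
Qed.

(* The Laplacian of [|phi|^2 + eps |z|^2] is [4 (|phi1|^2 + eps) > 0], so its second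
   derivative is positive along one of the directions 1 and i. *)
Lemma no_interior_max (phi phi1 : C -> C) (phi2 z : C) (rad eps : R) :
  (0 < eps)%R -> (Cmod z < rad)%R ->
  (forall y, (Cmod y < rad)%R -> Cderiv phi y (phi1 y)) ->
  Cderiv phi1 z phi2 ->
  exists y, (Cmod y < rad)%R /\
    (Cmod (phi z)%C ^ 2 + eps * Cmod z ^ 2 < Cmod (phi y)%C ^ 2 + eps * Cmod y ^ 2)%R.
Proof.
intros Heps Hz H1 H2.
set (u := fun y : C => (Cmod (phi y)%C ^ 2 + eps * Cmod y ^ 2)%R).
set (k := fun v => (2 * (Cdot (phi1 z * v)%C (phi1 z * v)%C + Cdot (phi z)%C (phi2 * v * v)%C
   + eps * Cdot v v))%R).
assert (Hline : forall v, Cmod v = 1%R -> (0 < k v)%R ->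
  exists y, (Cmod y < rad)%R /\ (u z < u y)%R).
{ intros v Hv Hk.
  assert (Hin : forall t, (Rabs t < rad - Cmod z)%R -> (Cmod (z + RtoC t * v)%C < rad)%R).
  { intros t Ht; eapply Rle_lt_trans; [apply Cmod_triangle|].
    rewrite Cmod_mult, Cmod_R, Hv; lra. }
  destruct (positive_second_derivative (fun t => u (z + RtoC t * v)%C)
    (fun t => 2 * (Cdot (phi (z + RtoC t * v))%C (phi1 (z + RtoC t * v) * v)%C
       + eps * Cdot (z + RtoC t * v)%C v))%R (rad - Cmod z)%R (k v))
    as [t [Ht Hlt]]; [lra|exact Hk| | |].
  - intros t Ht.
    assert (D := H1 _ (Hin t Ht)).
    apply (is_derive_ext (fun t => Cdot (phi (z + RtoC t * v))%C (phi (z + RtoC t * v))%C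
       + eps * Cdot (z + RtoC t * v)%C (z + RtoC t * v)%C)%R).
    { intros s; unfold u; now rewrite !Cdot_diag. }
    refine (eq_ind _ (fun d : R => is_derive _ t d)
      (@is_derive_plus _ _ _ _ _ _ _ (is_derive_Cdot_line phi phi z v _ _ t D D)
       (is_derive_scal _ _ eps _ (is_derive_Cdot_line (fun x => x) (fun x => x) z v _ _ t (Cderiv_id _) (Cderiv_id _)))) _ _).
    unfold plus, scal; simpl; unfold mult, Cdot; simpl.
    destruct (phi _), (phi1 _), z, v; simpl; ring.
  - assert (Hz0 : z + RtoC 0 * v = z) by ring.
    assert (D := H1 _ Hz); rewrite <- Hz0 in D at 1.
    assert (D2 := H2); rewrite <- Hz0 in D2 at 1.
    assert (D3 := Cderiv_mult _ _ _ _ _ D2 (Cderiv_const v _)).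
    refine (eq_ind _ (fun d : R => is_derive _ 0%R d)
      (is_derive_scal _ _ 2%R _
      (@is_derive_plus _ _ _ _ _ _ _ (is_derive_Cdot_line phi (fun y => phi1 y * v) z v _ _ 0%R D D3)
       (is_derive_scal _ _ eps _ (is_derive_Cdot_line (fun x => x) (fun _ => v) z v _ _ 0%R (Cderiv_id _) (Cderiv_const v _))))) _ _).
    rewrite Hz0; unfold k, plus, scal; simpl; unfold mult, Cdot; simpl.
    destruct (phi _), (phi1 _), phi2, z, v; simpl; ring.
  - exists (z + RtoC t * v); split; [now apply Hin|].
    replace (z + RtoC 0 * v) with z in Hlt by ring; exact Hlt. }
(* [k v] is the second derivative in direction [v]. Since 1^2 + i^2 = 0, the terms with [phi2]
   cancel in the sum, which is the Laplacian. *)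
assert (Hsum : (0 < k 1 + k Ci)%R).
{ replace (k 1 + k Ci)%R with (4 * (Cmod (phi1 z)%C ^ 2 + eps))%R.
  - generalize (pow2_ge_0 (Cmod (phi1 z)%C)); lra.
  - rewrite <- Cdot_diag; unfold k, Cdot; destruct (phi1 z), (phi z), phi2; simpl; ring. }
destruct (Rlt_le_dec 0 (k 1)) as [Hk|Hk].
- apply (Hline 1); [apply Cmod_1|exact Hk].
- apply (Hline Ci); [apply Cmod_Ci|lra].
Qed.

Lemma Cmod_sqr_usc (b : C) (e : R) : (0 < e)%R ->
  exists d : R, (0 < d)%R /\
    forall a : C, (Cmod (a - b)%C < d)%R -> (Cmod a ^ 2 < Cmod b ^ 2 + e)%R.
Proof.
intros He; assert (Hb := Cmod_ge_0 b).
exists (Rmin 1 (e / (2 * Cmod b + 1))); split.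
{ apply Rmin_pos; [lra|apply Rdiv_lt_0_compat; lra]. }
intros a Ha.
assert (H1 := Rlt_le_trans _ _ _ Ha (Rmin_l _ _)).
assert (H2 := Rlt_le_trans _ _ _ Ha (Rmin_r _ _)).
apply (Rlt_div_r _ _ (2 * Cmod b + 1)) in H2; [|lra].
assert (T := Cmod_triangle (a - b) b).
replace (a - b + b) with a in T by ring.
assert (H0 := Cmod_ge_0 a); assert (H3 := Cmod_ge_0 (a - b)).
simpl; nra.
Qed.

(** Adding eps |z|^2 makes the squared modulus strictly subharmonic, so its maximum over the closed
    disc lies on the circle; eps is then made small against the supposed excess over M^2. *)
Lemma weak_maximum_modulus (phi phi1 phi2 : C -> C) (rad M : R) :
  (0 < rad)%R ->
  (forall y, (Cmod y <= rad)%R -> Cderiv phi y (phi1 y)) ->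
  (forall y, (Cmod y < rad)%R -> Cderiv phi1 y (phi2 y)) ->
  (forall y, Cmod y = rad -> (Cmod (phi y)%C <= M)%R) ->
  forall z, (Cmod z <= rad)%R -> (Cmod (phi z)%C <= M)%R.
Proof.
intros Hrad H1 H2 HM z Hz.
assert (HM0 : (0 <= M)%R).
{ eapply Rle_trans; [|apply (HM rad)]; [apply Cmod_ge_0|].
  rewrite Cmod_R; apply Rabs_pos_eq; lra. }
assert (Hall : forall eps : R, (0 < eps)%R ->
  (Cmod (phi z)%C ^ 2 <= M ^ 2 + eps * rad ^ 2)%R).
{ intros eps Heps.
  set (u := fun y : C => (Cmod (phi y)%C ^ 2 + eps * Cmod y ^ 2)%R).
  destruct (compact_attains_max (fun y => (Cmod y <= rad)%R) u rad)
    as [w [Hw Hmax]]; [auto| | |now exists z|].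
  - intros y Hy; apply Rnot_le_lt in Hy.
    exists (Cmod y - rad)%R; split; [lra|]; intros x Hx Hxr.
    assert (T := Cmod_triangle x (y - x)).
    replace (x + (y - x)) with y in T by ring.
    replace (y - x) with (- (x - y)) in T by ring; rewrite Cmod_opp in T; lra.
  - intros y Hy e He.
    destruct (Cmod_sqr_usc (phi y) (e / 2)%R ltac:(lra)) as [a1 [Ha1 Ha1']].
    destruct (Cmod_sqr_usc y (e / 2 / eps)%R) as [a2 [Ha2 Ha2']];
      [apply Rdiv_lt_0_compat; lra|].
    destruct (Cderiv_continuous _ _ _ (H1 y Hy) a1 Ha1) as [d [Hd0 Hd]].
    exists (Rmin d a2); split; [now apply Rmin_pos|].
    intros x _ Hx; unfold u.
    assert (Hx1 := Ha1' _ (Hd x (Rlt_le_trans _ _ _ Hx (Rmin_l _ _)))).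
    assert (Hx2 := Ha2' x (Rlt_le_trans _ _ _ Hx (Rmin_r _ _))).
    apply (Rmult_lt_compat_l eps) in Hx2; [|lra].
    replace (eps * (Cmod y ^ 2 + e / 2 / eps))%R
      with (eps * Cmod y ^ 2 + e / 2)%R in Hx2 by (field; lra).
    lra.
  - apply (Rle_trans _ (u z)).
    { unfold u; generalize (pow2_ge_0 (Cmod z)); nra. }
    apply (Rle_trans _ (u w)); [now apply Hmax|].
    assert (Hwr : Cmod w = rad).
    { destruct (Rle_lt_or_eq_dec _ _ Hw) as [Hlt|]; [|assumption]; exfalso.
      destruct (no_interior_max phi phi1 (phi2 w) w rad eps Heps Hlt) as [y [Hy Hgt]].
      - intros y Hy; apply H1; lra.
      - now apply H2.
      - specialize (Hmax y ltac:(lra)); unfold u in Hmax; lra. }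
    specialize (HM w Hwr); unfold u; rewrite Hwr.
    generalize (Cmod_ge_0 (phi w)); intros; nra. }
apply Rnot_lt_le; intros Hlt.
set (e := ((Cmod (phi z)%C ^ 2 - M ^ 2) / (2 * rad ^ 2))%R).
assert (He : (0 < Cmod (phi z)%C ^ 2 - M ^ 2)%R) by nra.
assert (Hr2 : (0 < rad ^ 2)%R) by (apply pow_lt; lra).
specialize (Hall e ltac:(apply Rdiv_lt_0_compat; lra)).
replace (e * rad ^ 2)%R with ((Cmod (phi z)%C ^ 2 - M ^ 2) / 2)%R in Hall
  by (unfold e; field; lra).
lra.
Qed.

(** * Jack's lemma and a uniqueness principle *)

(** On a circle of radius rho < r the hypothesis reads |p/h| < 1/rho. The maximum principle carries
    this bound inside, and rho tends to r. *)
Lemma schwarz_quotient (p p1 p2 h h1 h2 : C -> C) (r : R) :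
  (forall z, (Cmod z < r)%R -> Cderiv p z (p1 z)) ->
  (forall z, (Cmod z < r)%R -> Cderiv p1 z (p2 z)) ->
  (forall z, (Cmod z < r)%R -> Cderiv h z (h1 z)) ->
  (forall z, (Cmod z < r)%R -> Cderiv h1 z (h2 z)) ->
  (forall z, (Cmod z < r)%R -> (Cmod (z * p z)%C < Cmod (h z)%C)%R) ->
  forall z, (Cmod z < r)%R -> (r * Cmod (p z)%C <= Cmod (h z)%C)%R.
Proof.
intros Dp Dp1 Dh Dh1 Hlt z Hz.
assert (Hh : forall y, (Cmod y < r)%R -> h y <> 0).
{ intros y Hy; apply Cmod_gt_0.
  eapply Rle_lt_trans; [apply Cmod_ge_0|apply Hlt, Hy]. }
assert (Hz0 := Cmod_ge_0 z).
assert (Hrho : forall rho, (Cmod z < rho < r)%R -> (rho * Cmod (p z)%C <= Cmod (h z)%C)%R).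
{ intros rho Hrho.
  assert (Hmax : (Cmod (p z / h z)%C <= / rho)%R).
  { apply (weak_maximum_modulus (fun y => p y / h y)
      (fun y => (p1 y * h y - p y * h1 y) / (h y * h y))
      (fun y => ((p2 y * h y + p1 y * h1 y - (p1 y * h1 y + p y * h2 y)) * (h y * h y)
        - (p1 y * h y - p y * h1 y) * (h1 y * h y + h y * h1 y))
        / ((h y * h y) * (h y * h y))) rho); [lra| | | |lra].
    - intros y Hy; apply Cderiv_div; [apply Hh|apply Dp|apply Dh]; lra.
    - intros y Hy; assert (Hy' : (Cmod y < r)%R) by lra.
      apply (Cderiv_div (fun y => p1 y * h y - p y * h1 y) (fun y => h y * h y)).
      + now apply Cmult_neq_0; apply Hh.
      + now apply Cderiv_minus; apply Cderiv_mult; auto.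
      + now apply Cderiv_mult; auto.
    - intros y Hy; assert (Hy' : (Cmod y < r)%R) by lra.
      assert (H0 := proj1 (Cmod_gt_0 _) (Hh y Hy')).
      specialize (Hlt y Hy'); rewrite Cmod_mult, Hy in Hlt.
      rewrite Cmod_div by now apply Hh.
      apply (Rmult_le_reg_l rho); [lra|]; rewrite Rinv_r by lra.
      unfold Rdiv; rewrite <- Rmult_assoc; apply Rle_div_l; lra. }
  assert (H0 := proj1 (Cmod_gt_0 _) (Hh z Hz)).
  rewrite Cmod_div in Hmax by now apply Hh.
  apply Rle_div_l in Hmax; [|exact H0].
  apply (Rmult_le_compat_l rho) in Hmax; [|lra].
  rewrite <- Rmult_assoc, Rinv_r in Hmax; lra. }
apply Rnot_lt_le; intros Hn.
assert (Hp0 := Cmod_ge_0 (p z)).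
assert (H0 := Cmod_ge_0 (h z)).
assert (Hp : (0 < Cmod (p z)%C)%R) by nra.
set (k := (Cmod (h z)%C / Cmod (p z)%C)%R).
assert (Hk : (k < r)%R) by (apply Rlt_div_l; lra).
(* If the claim failed, [k = |h z| / |p z|] would be below [r]; this [rho] exceeds both [k] and |z|
   and is still below [r]. *)
set (rho := Rmax ((Cmod z + r) / 2) ((k + r) / 2)).
assert (H1 := Rmax_l ((Cmod z + r) / 2) ((k + r) / 2)).
assert (H2 := Rmax_r ((Cmod z + r) / 2) ((k + r) / 2)).
assert (H3 : (rho < r)%R) by (apply Rmax_lub_lt; lra).
fold rho in H1, H2.
specialize (Hrho rho ltac:(lra)).
apply (Rle_div_r rho _ (Cmod (p z)%C)) in Hrho; [|lra].
fold k in Hrho; lra.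
Qed.

(** Along the ray through [z0], |h|^2 - |z0|^2 |p|^2 is nonnegative for parameters in [0, 1) and
    vanishes at 1, so its derivative [L] there cannot be positive. *)
Lemma boundary_radial_derivative (p h : C -> C) (p1 h1 z0 : C) :
  Cderiv p z0 p1 -> Cderiv h z0 h1 -> (0 < Cmod z0)%R ->
  (forall z, (Cmod z < Cmod z0)%R -> (Cmod z0 * Cmod (p z)%C <= Cmod (h z)%C)%R) ->
  (Cmod z0 * Cmod (p z0)%C)%R = Cmod (h z0)%C ->
  (Cdot (h z0)%C (h1 * z0)%C <= Cmod z0 ^ 2 * Cdot (p z0)%C (p1 * z0)%C)%R.
Proof.
intros Dp Dh Hz0 Hin Heq.
set (L := (2 * (Cdot (h z0)%C (h1 * z0)%C - Cmod z0 ^ 2 * Cdot (p z0)%C (p1 * z0)%C))%R).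
enough (L <= 0)%R by (unfold L in *; lra).
apply Rnot_lt_le; intros HL.
set (N := fun t : R => (Cdot (h (0 + RtoC t * z0))%C (h (0 + RtoC t * z0))%C
  - Cmod z0 ^ 2 * Cdot (p (0 + RtoC t * z0))%C (p (0 + RtoC t * z0))%C)%R).
assert (E : 0 + RtoC 1 * z0 = z0) by ring.
assert (DN : is_derive N 1%R L).
{ rewrite <- E in Dp at 1; rewrite <- E in Dh at 1.
  refine (eq_ind _ (fun d : R => is_derive _ 1%R d)
    (@is_derive_minus _ _ _ _ _ _ _ (is_derive_Cdot_line h h 0 z0 _ _ 1%R Dh Dh)
      (is_derive_scal _ _ (Cmod z0 ^ 2) _ (is_derive_Cdot_line p p 0 z0 _ _ 1%R Dp Dp))) _ _).
  rewrite E; unfold L; set (m := (Cmod z0 ^ 2)%R).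
  unfold minus, plus, opp, scal; simpl; unfold mult, Cdot; simpl.
  destruct (h z0), (p z0), h1, p1, z0; simpl; ring. }
apply is_derive_Reals in DN.
destruct (DN (L / 2)%R ltac:(lra)) as [d Hd].
assert (Hd0 := cond_pos d).
set (s := (Rmin d 1 / 2)%R).
assert (Hs0 : (0 < Rmin d 1)%R) by (apply Rmin_pos; lra).
assert (Hs1 := Rmin_l d 1); assert (Hs2 := Rmin_r d 1).
specialize (Hd (- s)%R ltac:(unfold s; lra)
  ltac:(rewrite Rabs_Ropp, Rabs_pos_eq; unfold s; lra)).
assert (N1 : N 1%R = 0%R).
{ unfold N; rewrite E, !Cdot_diag, <- Heq; ring. }
assert (Ns : (0 <= N (1 + - s))%R).
{ unfold N; rewrite !Cdot_diag.
  set (y := 0 + RtoC (1 + - s) * z0).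
  assert (Hy : (Cmod y < Cmod z0)%R).
  { unfold y; rewrite Cplus_0_l, Cmod_mult, Cmod_R, Rabs_pos_eq by (unfold s; lra).
    unfold s; nra. }
  specialize (Hin y Hy).
  assert (0 <= Cmod (p y)%C)%R by apply Cmod_ge_0.
  assert (0 <= Cmod z0 * Cmod (p y)%C)%R by nra.
  nra. }
rewrite N1 in Hd; apply Rabs_lt_between in Hd.
replace ((N (1 + - s) - 0) / - s)%R with (- (N (1 + - s) / s))%R in Hd
  by (field; unfold s; lra).
assert (0 <= N (1 + - s) / s)%R by (apply Rdiv_le_0_compat; [exact Ns|unfold s; lra]).
lra.
Qed.

(** |z| is minimised over the compact set where |z| <= |w| and |h| <= |g|. If |h| < |g| held at the
    minimiser, a slightly shorter multiple of it would by continuity still lie in the set. *)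
Lemma first_contact (g g1 h h1 : C -> C) (w : C) :
  (forall z, (Cmod z < 1)%R -> Cderiv g z (g1 z)) ->
  (forall z, (Cmod z < 1)%R -> Cderiv h z (h1 z)) ->
  (Cmod (g 0)%C < Cmod (h 0)%C)%R ->
  (Cmod w < 1)%R -> (Cmod (h w)%C <= Cmod (g w)%C)%R ->
  exists z0, (0 < Cmod z0 < 1)%R /\ Cmod (g z0)%C = Cmod (h z0)%C /\
    forall z, (Cmod z < Cmod z0)%R -> (Cmod (g z)%C < Cmod (h z)%C)%R.
Proof.
intros Dg Dh H0 Hw Hgw.
assert (Hopen : forall z, (Cmod z < 1)%R -> forall e : R, (0 < e)%R ->
  exists d : R, (0 < d)%R /\ forall y, (Cmod (y - z)%C < d)%R ->
    (Rabs ((Cmod (h y)%C - Cmod (g y)%C) - (Cmod (h z)%C - Cmod (g z)%C)) < e)%R).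
{ intros z Hz e He.
  destruct (Cderiv_continuous _ _ _ (Dg z Hz) (e / 2)%R ltac:(lra)) as [d1 [Hd1 Hd1']].
  destruct (Cderiv_continuous _ _ _ (Dh z Hz) (e / 2)%R ltac:(lra)) as [d2 [Hd2 Hd2']].
  exists (Rmin d1 d2); split; [now apply Rmin_pos|].
  intros y Hy.
  specialize (Hd1' y (Rlt_le_trans _ _ _ Hy (Rmin_l _ _))).
  specialize (Hd2' y (Rlt_le_trans _ _ _ Hy (Rmin_r _ _))).
  assert (Tri : forall u v : C, (Rabs (Cmod u - Cmod v) <= Cmod (u - v)%C)%R)
    by (intros u v; apply (@norm_triangle_inv C_AbsRing C_NormedModule)).
  assert (T1 := Tri (g y) (g z)); assert (T2 := Tri (h y) (h z)).
  apply Rabs_le_between in T1; apply Rabs_le_between in T2.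
  apply Rabs_lt_between; lra. }
destruct (compact_attains_max
  (fun z => (Cmod z <= Cmod w)%R /\ (Cmod (h z)%C <= Cmod (g z)%C)%R)
  (fun z => - Cmod z)%R (Cmod w)) as [z0 [[Hz0 Hgz0] Hmin]].
- now intros z [Hz _].
- intros z Hz.
  destruct (Rle_lt_dec (Cmod z) (Cmod w)) as [Hle|Hlt].
  + assert (Hpos : (0 < Cmod (h z)%C - Cmod (g z)%C)%R)
      by (apply Rnot_le_lt; intros Hn; apply Hz; split; lra).
    destruct (Hopen z ltac:(lra) _ Hpos) as [d [Hd0 Hd]].
    exists d; split; [exact Hd0|]; intros y Hy [_ Hy'].
    specialize (Hd y Hy); apply Rabs_lt_between in Hd; lra.
  + exists (Cmod z - Cmod w)%R; split; [lra|]; intros y Hy [Hy' _].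
    assert (T := Cmod_triangle y (- (y - z))).
    replace (y + - (y - z)) with z in T by ring; rewrite Cmod_opp in T; lra.
- intros z _ e He; exists e; split; [exact He|]; intros y _ Hy.
  assert (T := Cmod_triangle y (- (y - z))).
  replace (y + - (y - z)) with z in T by ring; rewrite Cmod_opp in T; lra.
- exists w; split; [apply Rle_refl|exact Hgw].
- assert (Hpos : (0 < Cmod z0)%R).
  { apply Cmod_gt_0; intros E; rewrite E in Hgz0; lra. }
  assert (Hbelow : forall z, (Cmod z < Cmod z0)%R -> (Cmod (g z)%C < Cmod (h z)%C)%R).
  { intros z Hz; apply Rnot_le_lt; intros Hn.
    specialize (Hmin z ltac:(split; lra)); lra. }
  exists z0; split; [lra|]; split; [|exact Hbelow].
  destruct (Rle_lt_or_eq_dec _ _ Hgz0) as [Hlt|Heq]; [exfalso|now symmetry].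
  destruct (Hopen z0 ltac:(lra) (Cmod (g z0)%C - Cmod (h z0)%C)%R ltac:(lra)) as [d [Hd0 Hd]].
  set (s := (Rmin d 1 / 2)%R).
  assert (Hs0 : (0 < Rmin d 1)%R) by (apply Rmin_pos; lra).
  assert (Hs1 := Rmin_l d 1); assert (Hs2 := Rmin_r d 1).
  assert (Hy : (Cmod (RtoC (1 - s) * z0)%C < Cmod z0)%R).
  { rewrite Cmod_mult, Cmod_R, Rabs_pos_eq by (unfold s; lra); unfold s; nra. }
  apply Hbelow in Hy.
  specialize (Hd (RtoC (1 - s) * z0)).
  replace (RtoC (1 - s) * z0 - z0) with (RtoC (- s) * z0) in Hd
    by (rewrite RtoC_minus, RtoC_opp; ring).
  rewrite Cmod_mult, Cmod_R, Rabs_Ropp, Rabs_pos_eq in Hd by (unfold s; lra).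
  specialize (Hd ltac:(unfold s; nra)).
  apply Rabs_lt_between in Hd; lra.
Qed.

(* Jack's lemma for the function [z * p z / h z]: at a point [z0] of minimal modulus
   where it reaches the unit circle, Schwarz's lemma bounds its radial derivative. *)
Lemma jack_contact (p p1 p2 h h1 h2 : C -> C) (w : C) :
  (forall z, (Cmod z < 1)%R -> Cderiv p z (p1 z)) ->
  (forall z, (Cmod z < 1)%R -> Cderiv p1 z (p2 z)) ->
  (forall z, (Cmod z < 1)%R -> Cderiv h z (h1 z)) ->
  (forall z, (Cmod z < 1)%R -> Cderiv h1 z (h2 z)) ->
  h 0 <> 0 -> (Cmod w < 1)%R -> (Cmod (h w)%C <= Cmod (w * p w)%C)%R ->
  exists z0, (0 < Cmod z0 < 1)%R /\ Cmod (z0 * p z0)%C = Cmod (h z0)%C /\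
    (Cdot (h z0)%C (z0 * h1 z0)%C <= Cdot (z0 * p z0)%C (z0 * (z0 * p1 z0))%C)%R.
Proof.
intros Dp Dp1 Dh Dh1 H0 Hw Hgw.
destruct (first_contact (fun z => z * p z) (fun z => 1 * p z + z * p1 z) h h1 w)
  as [z0 [Hz0 [Heq Hlt]]]; auto.
- intros z Hz; apply Cderiv_mult; [apply Cderiv_id|now apply Dp].
- rewrite Cmult_0_l, Cmod_0; now apply Cmod_gt_0.
- exists z0; split; [exact Hz0|]; split; [exact Heq|].
  assert (B := boundary_radial_derivative p h (p1 z0) (h1 z0) z0
    (Dp z0 ltac:(lra)) (Dh z0 ltac:(lra)) ltac:(lra)).
  replace (z0 * h1 z0) with (h1 z0 * z0) by ring.
  (* For g = z p one has z (z p') = z g' - g; this is the origin of the extra |G|^2 in the contact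
     inequality. *)
  replace (Cdot (z0 * p z0)%C (z0 * (z0 * p1 z0))%C)
    with (Cmod z0 ^ 2 * Cdot (p z0)%C (p1 z0 * z0)%C)%R.
  + apply B; [|rewrite <- Heq; symmetry; apply Cmod_mult].
    apply (schwarz_quotient p p1 p2 h h1 h2); intros z Hz; auto;
      [apply Dp|apply Dp1|apply Dh|apply Dh1]; lra.
  + rewrite <- Cdot_diag; unfold Cdot; destruct z0, (p _), (p1 _); simpl; ring.
Qed.

Lemma Cdot_le (x y : C) : (Rabs (Cdot x y) <= Cmod x * Cmod y)%R.
Proof.
unfold Cdot; eapply Rle_trans; [apply re_le_Cmod|].
rewrite Cmod_mult, Cmod_conj; apply Rle_refl.
Qed.

(* Gronwall on a ray towards the regular singular point 0: with [K >= 1 + 3 alpha],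
   [t ^ K * (|f|^2 + |f1|^2)] is nondecreasing in [t]. *)
Lemma second_order_unique (f f1 f2 : C -> C) (z0 : C) (alpha : R) :
  (Cmod z0 < 1)%R -> (0 <= alpha)%R ->
  (forall z, (Cmod z <= Cmod z0)%R -> Cderiv f z (f1 z)) ->
  (forall z, (Cmod z <= Cmod z0)%R -> Cderiv f1 z (f2 z)) ->
  (forall z, (Cmod z <= Cmod z0)%R ->
     (Cmod (z * f2 z)%C <= alpha * (Cmod (f z)%C + Cmod (f1 z)%C))%R) ->
  f z0 = 0 -> f1 z0 = 0 -> f 0 = 0.
Proof.
intros Hz0 Ha D1 D2 Hb E0 E1.
destruct (INR_unbounded (1 + 3 * alpha)) as [K HK].
set (e := fun t : R => (Cdot (f (0 + RtoC t * z0))%C (f (0 + RtoC t * z0))%C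
   + Cdot (f1 (0 + RtoC t * z0))%C (f1 (0 + RtoC t * z0))%C)%R).
set (e1 := fun t : R => (2 * (Cdot (f (0 + RtoC t * z0))%C (f1 (0 + RtoC t * z0) * z0)%C
   + Cdot (f1 (0 + RtoC t * z0))%C (f2 (0 + RtoC t * z0) * z0)%C))%R).
assert (Hin : forall t, (0 <= t <= 1)%R -> (Cmod (0 + RtoC t * z0)%C <= Cmod z0)%R).
{ intros t Ht; rewrite Cplus_0_l, Cmod_mult, Cmod_R, Rabs_pos_eq by lra.
  generalize (Cmod_ge_0 z0); nra. }
assert (De : forall t, (0 <= t <= 1)%R -> is_derive e t (e1 t)).
{ intros t Ht; assert (d1 := D1 _ (Hin t Ht)); assert (d2 := D2 _ (Hin t Ht)).
  refine (eq_ind _ (fun d : R => is_derive _ t d)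
    (@is_derive_plus _ _ _ _ _ _ _ (is_derive_Cdot_line f f 0 z0 _ _ t d1 d1)
      (is_derive_Cdot_line f1 f1 0 z0 _ _ t d2 d2)) _ _).
  unfold e1, plus; simpl; unfold Cdot.
  destruct (f _), (f1 _), (f2 _), z0; simpl; ring. }
assert (He1 : forall t, (0 <= t <= 1)%R -> (- (INR K * e t) <= t * e1 t)%R).
{ intros t Ht; specialize (Hb _ (Hin t Ht)); assert (Hm := Hin t Ht).
  set (z := 0 + RtoC t * z0) in *.
  replace (t * e1 t)%R with (2 * (Cdot (f z)%C (z * f1 z)%C + Cdot (f1 z)%C (z * f2 z)%C))%R.
  2: { assert (P : forall x y, (Cdot x (z * y) = t * Cdot x (y * z0))%R).
       { intros x y; unfold z; rewrite Cplus_0_l; unfold Cdot; destruct x, y, z0; simpl; ring. }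
       rewrite !P; unfold e1; fold z; ring. }
  unfold e; fold z; rewrite !Cdot_diag.
  assert (C1 := Cdot_le (f z) (z * f1 z)); assert (C2 := Cdot_le (f1 z) (z * f2 z)).
  rewrite Cmod_mult in C1.
  apply Rabs_le_between in C1; apply Rabs_le_between in C2.
  set (X := Cmod (f z)%C) in *; set (Y := Cmod (f1 z)%C) in *.
  assert (HX : (0 <= X)%R) by apply Cmod_ge_0.
  assert (HY : (0 <= Y)%R) by apply Cmod_ge_0.
  assert (Hzz := Cmod_ge_0 z).
  (* These bounds give 2 X Y + 2 alpha Y (X + Y) <= (1 + 3 alpha)(X^2 + Y^2), the source of the
     threshold for [K]. *)
  assert (B1 : (X * (Cmod z * Y) <= X * Y)%R) by (apply Rmult_le_compat_l; nra).
  assert (B2 : (Y * Cmod (z * f2 z)%C <= Y * (alpha * (X + Y)))%R)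
    by (apply Rmult_le_compat_l; assumption).
  assert (B3 : (2 * (X * Y) <= X ^ 2 + Y ^ 2)%R) by (generalize (pow2_ge_0 (X - Y)); lra).
  assert (B4 : (alpha * (2 * (X * Y)) <= alpha * (X ^ 2 + Y ^ 2))%R)
    by (apply Rmult_le_compat_l; assumption).
  assert (B5 : ((1 + 3 * alpha) * (X ^ 2 + Y ^ 2) <= INR K * (X ^ 2 + Y ^ 2))%R)
    by (apply Rmult_le_compat_r; nra).
  assert (B6 : (0 <= alpha * X ^ 2)%R) by nra.
  nra. }
assert (Hev : forall t, (0 < t < 1)%R -> f (RtoC t * z0) = 0).
{ intros t Ht.
  (* With exponent [S K] the derivative factors as c^K (K e + e + c e1), free of predecessors; the
     bracket is nonnegative by [He1]. The weight vanishes at t = 0, so [f 0] is reached afterwards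
     by continuity. *)
  assert (Hmono : (t ^ S K * e t <= 1 ^ S K * e 1)%R).
  { destruct (MVT_cor2 (fun t => t ^ S K * e t)%R
      (fun t => INR (S K) * t ^ K * e t + t ^ S K * e1 t)%R t 1) as [c [Hc Hct]]; [lra| |].
    - intros c Hc; apply (derivable_pt_lim_mult (fun t => t ^ S K)%R e).
      + apply (derivable_pt_lim_pow c (S K)).
      + apply is_derive_Reals, De; lra.
    - assert (Hec : (0 <= e c)%R)
        by (unfold e; rewrite !Cdot_diag; apply Rplus_le_le_0_compat; apply pow2_ge_0).
      specialize (He1 c ltac:(lra)).
      assert (Hck : (0 <= c ^ K)%R) by (apply pow_le; lra).
      assert (0 <= INR (S K) * c ^ K * e c + c ^ S K * e1 c)%R.
      { rewrite S_INR; simpl pow.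
        replace ((INR K + 1) * c ^ K * e c + c * c ^ K * e1 c)%R
          with (c ^ K * (INR K * e c + e c + c * e1 c))%R by ring.
        apply Rmult_le_pos; lra. }
      nra. }
  assert (Ee : e 1%R = 0%R).
  { unfold e; replace (0 + RtoC 1 * z0) with z0 by ring.
    rewrite E0, E1, !Cdot_diag, Cmod_0; ring. }
  rewrite Ee, Rmult_0_r in Hmono.
  assert (Htk : (0 < t ^ S K)%R) by (apply pow_lt; lra).
  assert (Het : (e t <= 0)%R) by nra.
  unfold e in Het; rewrite !Cdot_diag, Cplus_0_l in Het.
  apply Cmod_eq_0.
  generalize (pow2_ge_0 (Cmod (f1 (RtoC t * z0))%C)) (Cmod_ge_0 (f (RtoC t * z0))); nra. }
apply Cmod_eq_0, Rle_antisym; [|apply Cmod_ge_0].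
apply Rnot_lt_le; intros Hpos.
destruct (Cderiv_continuous _ _ _ (D1 0 ltac:(rewrite Cmod_0; apply Cmod_ge_0)) _ Hpos)
  as [d [Hd0 Hd]].
set (t := (Rmin d 1 / 2)%R).
assert (Hs0 : (0 < Rmin d 1)%R) by (apply Rmin_pos; lra).
assert (Hs1 := Rmin_l d 1); assert (Hs2 := Rmin_r d 1).
specialize (Hd (RtoC t * z0)).
rewrite Hev in Hd by (unfold t; lra).
replace (RtoC 0 - f 0) with (- f 0) in Hd by ring.
replace (RtoC t * z0 - 0) with (RtoC t * z0) in Hd by ring.
rewrite Cmod_opp, Cmod_mult, Cmod_R, Rabs_pos_eq in Hd by (unfold t; lra).
assert (Cmod (f 0)%C < Cmod (f 0)%C)%R; [apply Hd; unfold t; generalize (Cmod_ge_0 z0); nra|lra].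
Qed.

(** * The hypergeometric equation *)

Definition hyp_coeff (a b c : C) (n : nat) : C :=
  Cpochhammer a n * Cpochhammer b n / (Cpochhammer c n * RtoC (INR (fact n))).

Lemma hyp2F1_CPSeries (a b c z : C) : hyp2F1 a b c z = CPSeries (hyp_coeff a b c) z.
Proof. reflexivity. Qed.

Lemma plus_INR_neq_0 (c : C) (n : nat) : (0 < Re c)%R -> c + RtoC (INR n) <> 0.
Proof.
intros Hc E; apply (f_equal Re) in E; unfold Re in *; simpl in E.
generalize (pos_INR n); lra.
Qed.

Lemma Cpochhammer_neq_0 (c : C) (n : nat) : (0 < Re c)%R -> Cpochhammer c n <> 0.
Proof.
intros Hc; induction n as [|n IH]; simpl.
- intros E; apply (f_equal Re) in E; simpl in E; lra.
- apply Cmult_neq_0; [exact IH|now apply plus_INR_neq_0].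
Qed.

Lemma RtoC_INR_S_neq_0 (n : nat) : RtoC (INR (S n)) <> 0.
Proof.
intros E; apply RtoC_inj in E; revert E; apply not_0_INR; lia.
Qed.

(** The coefficient recurrence cleared of denominators; both the growth bound and the differential
    equation are read off from it. *)
Lemma hyp_coeff_S (a b c : C) (n : nat) : (0 < Re c)%R ->
  RtoC (INR (S n)) * (c + RtoC (INR n)) * hyp_coeff a b c (S n)
  = (a + RtoC (INR n)) * (b + RtoC (INR n)) * hyp_coeff a b c n.
Proof.
intros Hc.
assert (H1 := Cpochhammer_neq_0 c n Hc).
assert (H2 := plus_INR_neq_0 c n Hc).
assert (H3 := RtoC_INR_S_neq_0 n).
assert (H4 : RtoC (INR (fact n)) <> 0)
  by (intros E; apply RtoC_inj in E; revert E; apply INR_fact_neq_0).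
unfold hyp_coeff; rewrite fact_simpl, mult_INR, RtoC_mult.
simpl Cpochhammer; field; auto.
Qed.

Lemma eventually_nonincreasing_bounded (v : nat -> R) (N : nat) :
  (forall n, (N <= n)%nat -> (v (S n) <= v n)%R) -> exists M, forall n, (v n <= M)%R.
Proof.
revert v; induction N as [|N IH]; intros v H.
- exists (v O); intros n; induction n as [|n IHn]; [lra|].
  specialize (H n ltac:(lia)); lra.
- destruct (IH (fun n => v (S n))) as [M HM].
  { intros n Hn; apply H; lia. }
  exists (Rmax (v O) M); intros [|n]; [apply Rmax_l|].
  eapply Rle_trans; [apply HM|apply Rmax_r].
Qed.

(** A ratio test with rho = s^2, one factor [s] given to each numerator: (|a| + n) s <= n once n >=
    alpha s / (1 - s), likewise for [b], while |c + n| > n because Re c > 0. Hence |A_n| rho^n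
    eventually does not increase. *)
Lemma disc_coeff_hyp (a b c : C) : (0 < Re c)%R -> disc_coeff (hyp_coeff a b c).
Proof.
intros Hc rho Hr.
set (s := sqrt rho).
assert (Hs0 : (0 < s)%R) by (apply sqrt_lt_R0; lra).
assert (Hs : (s * s = rho)%R) by (apply sqrt_sqrt; lra).
assert (Hs1 : (s < 1)%R) by nra.
set (alpha := Rmax (Cmod a) (Cmod b)).
destruct (INR_unbounded (alpha * s / (1 - s))) as [N HN].
apply (eventually_nonincreasing_bounded _ N); intros n Hn.
assert (HnN : (alpha * s / (1 - s) < INR n)%R)
  by (apply le_INR in Hn; lra).
apply Rlt_div_l in HnN; [|lra].
assert (Hn0 := pos_INR n).
assert (E := f_equal Cmod (hyp_coeff_S a b c n Hc)%C).
rewrite !Cmod_mult, Cmod_R, Rabs_pos_eq in E by apply pos_INR.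
assert (Hbd : forall x : C, (Cmod x <= alpha)%R ->
  (0 <= Cmod (x + RtoC (INR n))%C * s <= INR n)%R).
{ intros x Hx; split; [apply Rmult_le_pos; [apply Cmod_ge_0|lra]|].
  assert (T := Cmod_triangle x (RtoC (INR n))).
  rewrite Cmod_R, Rabs_pos_eq in T by exact Hn0; nra. }
assert (Ha := Hbd a (Rmax_l _ _)); assert (Hb := Hbd b (Rmax_r _ _)).
assert (Hcn : (INR n < Cmod (c + RtoC (INR n))%C)%R).
{ apply (Rlt_le_trans _ (Re (c + RtoC (INR n))%C)); [unfold Re in *; simpl; lra|].
  eapply Rle_trans; [apply Rle_abs|apply re_le_Cmod]. }
rewrite S_INR in E.
set (X := Cmod (hyp_coeff a b c (S n))%C) in *; set (Y := Cmod (hyp_coeff a b c n)%C) in *.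
set (A := Cmod (a + RtoC (INR n))%C) in *; set (B := Cmod (b + RtoC (INR n))%C) in *.
set (D := Cmod (c + RtoC (INR n))%C) in *; set (m := INR n) in *.
assert (HX : (0 <= X)%R) by apply Cmod_ge_0.
assert (HY : (0 <= Y)%R) by apply Cmod_ge_0.
assert (Hp : (0 <= rho ^ n)%R) by (apply pow_le; lra).
enough (X * rho <= Y)%R by (simpl pow; nra).
assert (HAB : (A * s * (B * s) <= m * m)%R) by (apply Rmult_le_compat; lra).
assert (HmD : (m * m <= (m + 1) * D)%R) by nra.
assert (HD : (0 < (m + 1) * D)%R) by (apply Rmult_lt_0_compat; lra).
apply (Rmult_le_reg_l ((m + 1) * D)); [exact HD|].
rewrite <- Rmult_assoc, E, <- Hs.
replace (A * B * Y * (s * s))%R with (A * s * (B * s) * Y)%R by ring.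
apply Rmult_le_compat_r; lra.
Qed.

(** The general equation has c - (a + b + 1) z in front of F', which here factors as c (1 - z). On
    coefficients, [E n] equals both (n + c)(n + 1) A_{n+1} and (a + n)(b + n) A_n; for c = a + b + 1
    the difference E_{n+1} - E_n collapses to a b A_{n+1}. *)
Lemma hyp_ode (a b z : C) : (0 < Re (a + b + 1)%C)%R -> (Cmod z < 1)%R ->
  let A := hyp_coeff a b (a + b + 1) in
  (1 - z) * (z * CPSeries (der_coeff (der_coeff A)) z + (a + b + 1) * CPSeries (der_coeff A) z)
  = a * b * CPSeries A z.
Proof.
intros Hc Hz A; set (c := a + b + 1) in *.
assert (HA : disc_coeff A) by now apply disc_coeff_hyp.
assert (HB := disc_coeff_der _ HA).
assert (HT := disc_coeff_theta _ HB).
set (E := fun n => RtoC (INR n) * der_coeff A n + c * der_coeff A n).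
assert (HcB := disc_coeff_scal c _ HB).
assert (HE : disc_coeff E) by now apply disc_coeff_plus.
rewrite <- CPSeries_theta, <- (CPSeries_scal c (der_coeff A)), <- CPSeries_plus by auto.
fold E.
rewrite <- (CPSeries_scal (a * b) A) by auto.
assert (EA : forall n, E n = (a + RtoC (INR n)) * (b + RtoC (INR n)) * A n).
{ intros n; unfold E, der_coeff, A; rewrite <- hyp_coeff_S by exact Hc; fold c; ring. }
rewrite (CPSeries_decr_1 (fun n => a * b * A n)) by (auto; now apply disc_coeff_scal).
replace ((1 - z) * CPSeries E z) with (CPSeries E z + z * (- (1) * CPSeries E z)) by ring.
rewrite (CPSeries_decr_1 E z) at 1 by auto.
rewrite <- (CPSeries_scal (- (1)) E) by auto.
rewrite <- Cplus_assoc, <- Cmult_plus_distr_l.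
rewrite <- CPSeries_plus by (auto using disc_coeff_shift, disc_coeff_scal).
f_equal; [rewrite EA; simpl INR; ring|f_equal].
apply CPSeries_ext; intros n.
rewrite EA.
unfold E, der_coeff; fold A.
rewrite S_INR, RtoC_plus; unfold c; ring.
Qed.

(** * Contradiction at the contact point, and the theorem *)

(** z/(1 - z) + 1/2 is half the Cayley transform (1 + z)/(1 - z), which maps the disc into the right
    half-plane. *)
Lemma Re_div_one_minus (z : C) : (Cmod z < 1)%R -> (- (1 / 2) < Re (z / (1 - z))%C)%R.
Proof.
intros Hz.
assert (H0 := Cmod_ge_0 z).
assert (Hz2 : (Cmod z ^ 2 < 1)%R) by nra.
rewrite Cmod2_alt in Hz2; destruct z as [x y]; simpl Re in Hz2; simpl Im in Hz2.
assert (Hx : (x < 1)%R) by nra.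
set (D := ((1 - x) ^ 2 + y ^ 2)%R).
assert (HD : (0 < D)%R) by (unfold D; nra).
replace (Re ((x, y) / (1 - (x, y)))%C) with ((x - (x ^ 2 + y ^ 2)) / D)%R.
- apply Rlt_div_r; [exact HD|]; unfold D; nra.
- unfold D; simpl; field; simpl in *; nra.
Qed.

(* The case [|w| = |w + beta|] with [beta = 2 C (C, S)], [c = s + 1], of the radial
   inequality of [jack_contact] divided by [|F|^2], [w] being [z F'/F]. *)
Lemma contact_contradiction (Cl Sl q : R) (s w zeta : C) :
  (0 < Cl)%R -> (Cl * Cl + Sl * Sl = 1)%R -> (0 < q)%R ->
  ((1 + 2 * Cl * Cl) * (2 * Re s - (2 * Cl * Cl - 1) - q / Cl)
     - (Im s - 2 * Sl * Cl) ^ 2 >= 0)%R ->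
  (- (1 / 2) < Re zeta)%R ->
  let e : C := (Cl, Sl) in let beta := RtoC (2 * Cl) * e in
  Cmod w = Cmod (w + beta)%C ->
  (Cdot (w + beta)%C (w + (RtoC q * e * zeta - (s + 1) * w) + beta * w)%C
     <= Cdot w (RtoC q * e * zeta - (s + 1) * w))%R -> False.
Proof.
intros HC HCS Hq Hineq Hzeta e beta Hw Hrad.
set (w' := Cconj e * w).
assert (Ee : e * Cconj e = 1) by (unfold e; apply injective_projections; simpl; lra).
assert (Ew : w = e * w') by (unfold w'; rewrite Cmult_assoc, Ee; ring).
destruct w' as [x y].
(* The points with |w| = |w + beta| form the perpendicular bisector of 0 and - beta; after rotation
   by the conjugate of [e] it is the vertical line Re = - Cl. *)
assert (Hx : x = (- Cl)%R).
{ apply (f_equal (fun r => r ^ 2)%R) in Hw; rewrite !Cmod2_alt, Ew in Hw.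
  unfold beta, e in Hw; simpl in Hw.
  assert (HH : ((Cl * Cl + Sl * Sl) * (4 * Cl * (x + Cl)) = 0)%R) by lra.
  rewrite HCS in HH.
  apply (Rmult_eq_reg_l (4 * Cl)); lra. }
subst x.
set (Q := ((1 + 2 * Cl * Cl) * y ^ 2 + 2 * (Cl * (Im s - 2 * Sl * Cl)) * y
   + (Cl * Cl * (2 * Re s - (2 * Cl * Cl - 1)) + 2 * Cl * q * Re zeta))%R).
assert (HQ : (Q <= 0)%R).
{ apply Rminus_le_0 in Hrad.
  enough (E : (Cdot (w + beta)%C (w + (RtoC q * e * zeta - (s + 1) * w) + beta * w)%C
     - Cdot w (RtoC q * e * zeta - (s + 1) * w) = Q)%R) by lra.
  assert (HS2 : (Sl ^ 2 = 1 - Cl ^ 2)%R) by lra.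
  rewrite Ew; unfold Q, beta, e, Cdot; destruct s as [s1 s2], zeta as [z1 z2]; simpl.
  ring [HS2]. }
set (B := (Cl * (Im s - 2 * Sl * Cl))%R) in *.
set (A := (1 + 2 * Cl * Cl)%R) in *.
(* The constant term of [Q] with Re zeta lowered to -1/2, which makes A y^2 + 2 B y + D strictly
   less than [Q]. With this [D], A D - B^2 is Cl^2 times the hypothesis of the theorem. *)
set (D := (Cl * Cl * (2 * Re s - (2 * Cl * Cl - 1)) - Cl * q)%R).
assert (HA : (0 < A)%R) by (unfold A; nra).
assert (Hdisc : (0 <= A * D - B * B)%R).
{ replace (A * D - B * B)%R with (Cl * Cl *
    (A * (2 * Re s - (2 * Cl * Cl - 1) - q / Cl) - (Im s - 2 * Sl * Cl) ^ 2))%R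
    by (unfold A, B, D; field; lra).
  apply Rmult_le_pos; nra. }
assert (HQ0 : (A * y ^ 2 + 2 * B * y + D < 0)%R).
{ unfold Q in HQ; unfold D.
  assert (0 < Cl * q)%R by nra. nra. }
(* Multiplied by [A], the quadratic is (A y + B)^2 + (A D - B^2), a sum of nonnegative terms. *)
assert (HP : (A * (A * y ^ 2 + 2 * B * y + D) < 0)%R) by nra.
generalize (pow2_ge_0 (A * y + B)); nra.
Qed.

Lemma Cdot_mult_r (x y u : C) : Cdot (x * u)%C (y * u)%C = (Cmod u ^ 2 * Cdot x y)%R.
Proof. rewrite <- Cdot_diag; unfold Cdot; destruct x, y, u; simpl; ring. Qed.

(** Nonnegativity forces 2 Re (a + b) >= 2 Cl^2 - 1 + q/Cl > -1. So c = a + b + 1 is not 0 or a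
    negative integer, and no denominator of the series vanishes. *)
Lemma Re_c_pos (Cl Sl q : R) (a b : C) : (0 < Cl)%R -> (0 < q)%R ->
  ((1 + 2 * Cl * Cl) * (2 * Re (a + b)%C - (2 * Cl * Cl - 1) - q / Cl)
     - (Im (a + b)%C - 2 * Sl * Cl) ^ 2 >= 0)%R ->
  (0 < Re (a + b + 1)%C)%R.
Proof.
intros HC Hq Hineq.
assert (0 < q / Cl)%R by now apply Rdiv_lt_0_compat.
  generalize (pow2_ge_0 (Im (a + b)%C - 2 * Sl * Cl)); intros Hsq.
  assert (0 <= 2 * Re (a + b)%C - (2 * Cl * Cl - 1) - q / Cl)%R.
  { apply Rnot_lt_le; intros Hn; assert (0 < 1 + 2 * Cl * Cl)%R by nra; nra. }
  unfold Re in *; simpl in *; nra.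
Qed.

Lemma hyp_quotient_lt (Cl Sl q : R) (a b z : C) :
  let e : C := (Cl, Sl) in let beta := RtoC (2 * Cl) * e in
  let A := hyp_coeff a b (a + b + 1) in
  (0 < Cl)%R -> (Cl * Cl + Sl * Sl = 1)%R -> (0 < q)%R -> a * b = RtoC q * e ->
  ((1 + 2 * Cl * Cl) * (2 * Re (a + b)%C - (2 * Cl * Cl - 1) - q / Cl)
     - (Im (a + b)%C - 2 * Sl * Cl) ^ 2 >= 0)%R ->
  (Cmod z < 1)%R ->
  (Cmod (z * CPSeries (der_coeff A) z)%C
    < Cmod (z * CPSeries (der_coeff A) z + beta * CPSeries A z)%C)%R.
Proof.
intros e beta A HC HCS Hq Hab Hineq Hz.
assert (Hc := Re_c_pos Cl Sl q a b HC Hq Hineq).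
assert (HA : disc_coeff A) by now apply disc_coeff_hyp.
assert (HA1 := disc_coeff_der _ HA).
assert (HA2 := disc_coeff_der _ HA1).
assert (HA3 := disc_coeff_der _ HA2).
set (F := CPSeries A) in *; set (F1 := CPSeries (der_coeff A)) in *.
set (F2 := CPSeries (der_coeff (der_coeff A))).
set (F3 := CPSeries (der_coeff (der_coeff (der_coeff A)))).
assert (Hbeta : (0 < Re beta)%R) by (unfold beta, e; simpl; nra).
assert (HF0 : F 0 = 1).
{ unfold F; rewrite CPSeries_0; unfold A, hyp_coeff; simpl; field. }
assert (DF : forall y, (Cmod y < 1)%R -> Cderiv F y (F1 y))
  by (intros; now apply CPSeries_derive).
assert (DF1 : forall y, (Cmod y < 1)%R -> Cderiv F1 y (F2 y))
  by (intros; now apply CPSeries_derive).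
assert (DF2 : forall y, (Cmod y < 1)%R -> Cderiv F2 y (F3 y))
  by (intros; now apply CPSeries_derive).
apply Rnot_le_lt; intros Hcontra.
destruct (jack_contact F1 F2 F3 (fun y => y * F1 y + beta * F y)
  (fun y => 1 * F1 y + y * F2 y + beta * F1 y)
  (fun y => 0 * F1 y + 1 * F2 y + (1 * F2 y + y * F3 y) + beta * F2 y) z)
  as [z0 [Hz0 [Heq Hrad]]]; auto.
{ intros y Hy; apply Cderiv_plus; [|now apply Cderiv_scal, DF].
  apply (Cderiv_mult (fun y => y)); [apply Cderiv_id|now apply DF1]. }
{ intros y Hy; apply Cderiv_plus; [apply Cderiv_plus|now apply Cderiv_scal, DF1].
  - apply (Cderiv_mult (fun _ => 1)); [apply Cderiv_const|now apply DF1].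
  - apply (Cderiv_mult (fun y => y)); [apply Cderiv_id|now apply DF2]. }
{ rewrite HF0, Cmult_0_l, Cplus_0_l, Cmult_1_r; intros E.
  rewrite E in Hbeta; simpl in Hbeta; lra. }
assert (Hone : forall y, (Cmod y < 1)%R -> 1 - y <> 0).
{ intros y Hy E; apply (f_equal (fun x => Cmod (x + y)%C)) in E.
  replace (1 - y + y) with (RtoC 1) in E by ring.
  rewrite Cplus_0_l, Cmod_1 in E; lra. }
assert (ODE : forall y, (Cmod y < 1)%R ->
  y * F2 y = a * b * F y / (1 - y) - (a + b + 1) * F1 y).
{ intros y Hy; assert (O := hyp_ode a b y Hc Hy); cbv zeta in O.
  fold A F F1 F2 in O.
  change (CPSeries A y) with (F y) in O.
  change (CPSeries (der_coeff A) y) with (F1 y) in O.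
  change (CPSeries (der_coeff (der_coeff A)) y) with (F2 y) in O.
  rewrite <- O; field; now apply Hone. }
cbv beta in Heq, Hrad.
destruct (Ceq_dec (F z0) 0) as [E0|E0].
- assert (E1 : F1 z0 <> 0).
  { intros E1.
    assert (F 0 = 0); [|rewrite HF0 in *; now apply C1_nz].
    (* The constant comes from solving the equation for z F'' on |y| <= |z0|, where |1 - y| >= 1 -
       |z0|. *)
    apply (second_order_unique F F1 F2 z0
      (Cmod (a * b)%C / (1 - Cmod z0) + Cmod (a + b + 1)%C)); auto; [lra| | | |].
    - apply Rplus_le_le_0_compat; [|apply Cmod_ge_0].
      apply Rdiv_le_0_compat; [apply Cmod_ge_0|lra].
    - intros y Hy; apply DF; lra.
    - intros y Hy; apply DF1; lra.
    - intros y Hy; rewrite ODE by lra.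
      assert (H1y : (1 - Cmod z0 <= Cmod (1 - y)%C)%R).
      { assert (T := Cmod_triangle (1 - y) y).
        replace (1 - y + y) with (RtoC 1) in T by ring; rewrite Cmod_1 in T; lra. }
      eapply Rle_trans; [apply Cmod_triangle|].
      rewrite Cmod_opp, !Cmod_mult, Cmod_div, !Cmod_mult by (apply Hone; lra).
      rewrite <- Cmod_mult.
      set (X := Cmod (F y)%C); set (Y := Cmod (F1 y)%C); set (m := Cmod (a * b)%C).
      assert (HX : (0 <= X)%R) by apply Cmod_ge_0.
      assert (HY : (0 <= Y)%R) by apply Cmod_ge_0.
      assert (Hm : (0 <= m)%R) by apply Cmod_ge_0.
      assert (Hcm := Cmod_ge_0 (a + b + 1)).
      assert (B1 : (m * X / Cmod (1 - y)%C <= m / (1 - Cmod z0) * X)%R).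
      { replace (m / (1 - Cmod z0) * X)%R with (m * X / (1 - Cmod z0))%R by (field; lra).
        apply Rmult_le_compat_l; [now apply Rmult_le_pos|].
        apply Rinv_le_contravar; lra. }
      assert (B2 : (0 <= m / (1 - Cmod z0) * Y)%R).
      { apply Rmult_le_pos; [apply Rdiv_le_0_compat; lra|exact HY]. }
      assert (B3 : (0 <= Cmod (a + b + 1)%C * X)%R) by now apply Rmult_le_pos.
      lra. }
  assert (HG : (0 < Cmod (z0 * F1 z0)%C)%R).
  { rewrite Cmod_mult; apply Rmult_lt_0_compat; [lra|now apply Cmod_gt_0]. }
  assert (HG2 : (0 < Cdot (z0 * F1 z0)%C (z0 * F1 z0)%C)%R)
    by (rewrite Cdot_diag; now apply pow_lt).
  (* At a zero of F, H equals G and the terms with F'' on both sides agree; what remains is (1 + Re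
     beta) |G|^2 <= 0, impossible as Re beta > 0. *)
  rewrite E0 in Hrad.
  replace (z0 * (1 * F1 z0 + z0 * F2 z0 + beta * F1 z0))
    with (z0 * F1 z0 + beta * (z0 * F1 z0) + z0 * (z0 * F2 z0)) in Hrad by ring.
  replace (z0 * F1 z0 + beta * 0) with (z0 * F1 z0) in Hrad by ring.
  set (G := z0 * F1 z0) in *.
  replace (Cdot G (G + beta * G + z0 * (z0 * F2 z0)))
    with ((1 + Re beta) * Cdot G G + Cdot G (z0 * (z0 * F2 z0)))%R in Hrad
    by (unfold Cdot; destruct G, beta, (z0 * (z0 * F2 z0)); simpl; ring).
  nra.
- set (w := z0 * F1 z0 / F z0).
  assert (Ew : z0 * F1 z0 = w * F z0) by (unfold w; field; exact E0).
  assert (Hn : (0 < Cmod (F z0)%C)%R) by now apply Cmod_gt_0.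
  apply (contact_contradiction Cl Sl q (a + b) w (z0 / (1 - z0))); auto.
  + apply Re_div_one_minus; lra.
  + fold e beta.
    rewrite Ew in Heq.
    replace (w * F z0 + beta * F z0) with ((w + beta) * F z0) in Heq by ring.
    rewrite !Cmod_mult in Heq; apply (Rmult_eq_reg_r (Cmod (F z0)%C)); lra.
  + fold e beta.
    assert (E2 : z0 * (z0 * F2 z0)
      = (RtoC q * e * (z0 / (1 - z0)) - (a + b + 1) * w) * F z0).
    { rewrite ODE, Hab by lra; unfold w; field; split; [exact E0|apply Hone; lra]. }
    replace (z0 * (1 * F1 z0 + z0 * F2 z0 + beta * F1 z0))
      with (z0 * F1 z0 + z0 * (z0 * F2 z0) + beta * (z0 * F1 z0)) in Hrad by ring.
    rewrite E2, Ew in Hrad.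
    replace (w * F z0 + beta * F z0) with ((w + beta) * F z0) in Hrad by ring.
    set (Qc := RtoC q * e * (z0 / (1 - z0)) - (a + b + 1) * w) in *.
    replace (w * F z0 + Qc * F z0 + beta * (w * F z0))
      with ((w + Qc + beta * w) * F z0) in Hrad by ring.
    rewrite !Cdot_mult_r in Hrad.
    apply (Rmult_le_reg_l (Cmod (F z0)%C ^ 2)); [now apply pow_lt|exact Hrad].
Qed.

Theorem corollary1p5 (lam : R) (a b : C) (q : R)
  (hlam : (0 < Rabs lam < PI / 2)%R)
  (hq : RtoC q = (Cexp (- Ci * RtoC lam) * (a * b))%C)
  (hq0 : (0 < q)%R)
  (hineq : ((2 + cos (2 * lam))
              * (2 * Re (a + b)%C - cos (2 * lam) - q / cos lam)
            - (Im (a + b)%C - sin (2 * lam)) ^ 2 >= 0)%R) :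
  spirallike lam (fun z : C => (z * hyp2F1 a b (a + b + 1) z)%C).
Proof.
set (Cl := cos lam) in *; set (Sl := sin lam).
assert (HC : (0 < Cl)%R).
{ destruct hlam as [_ hlam]; apply Rabs_lt_between in hlam; apply cos_gt_0; lra. }
assert (HCS : (Cl * Cl + Sl * Sl = 1)%R).
{ generalize (sin2_cos2 lam); unfold Rsqr, Cl, Sl; lra. }
assert (Eexp : Cexp (- Ci * RtoC lam) = (Cl, - Sl)%R).
{ replace (- Ci * RtoC lam) with (0%R, (- lam)%R : R)
    by (apply injective_projections; simpl; ring).
  unfold Cexp; simpl Re; simpl Im.
  rewrite exp_0, cos_neg, sin_neg; fold Cl Sl.
  apply injective_projections; simpl; ring. }
set (e := (Cl, Sl) : C).
assert (Hab : a * b = RtoC q * e).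
{ rewrite hq, Eexp; transitivity ((Cl, - Sl)%R * e * (a * b)); [|ring].
  replace ((Cl, - Sl)%R * e) with (RtoC 1); [ring|].
  unfold e; apply injective_projections; simpl; lra. }
rewrite cos_2a_cos, sin_2a in hineq; fold Cl Sl in hineq.
replace (2 + (2 * Cl * Cl - 1))%R with (1 + 2 * Cl * Cl)%R in hineq by ring.
assert (Hlt := hyp_quotient_lt Cl Sl q a b).
cbv zeta in Hlt; fold e in Hlt.
set (A := hyp_coeff a b (a + b + 1)) in *; set (beta := RtoC (2 * Cl) * e) in *.
specialize (fun z => Hlt z HC HCS hq0 Hab hineq).
assert (HA : disc_coeff A).
{ apply disc_coeff_hyp, (Re_c_pos Cl Sl q a b); assumption. }
assert (HA1 := disc_coeff_der _ HA).
assert (Df : forall z, (Cmod z < 1)%R ->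
  Cderiv (fun z => z * hyp2F1 a b (a + b + 1) z) z
    (1 * CPSeries A z + z * CPSeries (der_coeff A) z)).
{ intros z Hz; apply (Cderiv_mult (fun z => z) (CPSeries A));
    [apply Cderiv_id|now apply CPSeries_derive]. }
(* At a zero of F the strict inequality would compare |z F'| with itself. *)
assert (HF : forall z, (Cmod z < 1)%R -> CPSeries A z <> 0).
{ intros z Hz E; specialize (Hlt z Hz).
  rewrite E, Cmult_0_r, Cplus_0_r in Hlt; lra. }
split; [|split; [|split; [|split]]].
- intros z Hz; eexists; now apply Df.
- apply Cmult_0_l.
- rewrite (Cderiv_C_derive _ _ _ (Df 0 ltac:(rewrite Cmod_0; lra))).
  rewrite CPSeries_0; unfold A, hyp_coeff; simpl; field.
- intros z Hz Hz0; rewrite hyp2F1_CPSeries; apply Cmult_neq_0; [exact Hz0|now apply HF].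
- intros z Hz; unfold zdlog; rewrite Eexp.
  destruct (Ceq_dec z 0) as [_|Hz0]; [simpl; lra|].
  rewrite (Cderiv_C_derive _ _ _ (Df z Hz)), hyp2F1_CPSeries; fold A.
  specialize (HF z Hz); specialize (Hlt z Hz).
  set (F := CPSeries A z) in *; set (F1 := CPSeries (der_coeff A) z) in *.
  set (w' := (Cl, - Sl)%R * (z * F1 / F)).
  assert (Ee : (Cl, - Sl)%R * e = 1)
    by (unfold e; apply injective_projections; simpl; lra).
  assert (Ew : z * F1 = e * w' * F).
  { unfold w'; transitivity ((Cl, - Sl)%R * e * (z * F1));
      [rewrite Ee; ring|field; exact HF]. }
  (* The logarithmic derivative of z F is 1 + z F'/F, so the target is Re w' > - Cl. *)
  replace ((Cl, - Sl)%R * (z * (1 * F + z * F1) / (z * F))) with ((Cl, - Sl)%R + w')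
    by (unfold w'; field; auto).
  rewrite Ew in Hlt.
  replace (e * w' * F + beta * F) with ((e * w' + beta) * F) in Hlt by ring.
  rewrite (Cmod_mult (e * w')), (Cmod_mult (e * w' + beta)) in Hlt.
  apply Rmult_lt_reg_r in Hlt; [|now apply Cmod_gt_0].
  assert (H0 := Cmod_ge_0 (e * w')).
  assert (Hsq : (Cmod (e * w')%C ^ 2 < Cmod (e * w' + beta)%C ^ 2)%R) by (simpl; nra).
  rewrite !Cmod2_alt in Hsq; clearbody w'; destruct w' as [x y].
  unfold beta, e in Hsq; simpl in Hsq; simpl.
  (* The right side is |e w' + beta|^2 - |e w'|^2, with |e|^2 kept as a factor until [HCS] replaces
     it by 1. *)
  assert (HH : (0 < (Cl * Cl + Sl * Sl) * (4 * Cl * (x + Cl)))%R) by lra.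
  rewrite HCS in HH; nra.
Qed.
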